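(* Let $n\ge 2$ agents communicate over an undirected connected weighted graph with Laplacian $L$. Let $f_1,\dots,f_n:\mathbb{R}^d\to\mathbb{R}$ be differentiable with $\|\nabla f_i(x)-\nabla f_i(y)\|\le L_f\|x-y\|$ for all $x,y\in\mathbb{R}^d$, $i\in[n]$, where $L_f>0$. Let $f=\frac1n\sum_{i=1}^n f_i$ and assume that $f^*=\min_{x\in\mathbb{R}^d}f(x)$ is finite. Let $\mathcal{C}:\mathbb{R}^d\to\mathbb{R}^d$ be a (possibly random) compressor such that, for some real number $p\ge1$ and constant $C\ge0$, $\mathbf{E}_{\mathcal{C}}[\|\mathcal{C}(x)-x\|_p^2]\le C$ for all $x\in\mathbb{R}^d$. Let $\{x_{i,k}\}$ be generated by Algorithm 3 (see context) with $\alpha=\kappa_1\beta$, $\beta>\kappa_2$, $\eta\in(0,\tilde\kappa_3)$ and $s_k=s_0\gamma^k$, where $\kappa_1,\kappa_2,\tilde\kappa_3$ are the positive constants defined in the context, $s_0>0$ is arbitrary and $\gamma\in(0,1)$ is arbitrary. Let $\bar x_k=\frac1n\sum_{i=1}^n x_{i,k}$. Then, for any $T\in\mathbb{N}_0$, $$\sum_{k=0}^{T}\sum_{i=1}^{n}\mathbf{E}_{\mathcal{C}}\big[\|x_{i,k}-\bar{x}_k\|^2+\|\nabla f(\bar{x}_k)\|^2\big]=\mathcal{O}(1),\qquad \mathbf{E}_{\mathcal{C}}[f(\bar{x}_{T})-f^*]=\mathcal{O}(1),$$ where $\mathcal{O}(1)$ means bounded by a constant independent of $T$.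
   Context: Notation: $\mathbb{N}_0$ is the set of nonnegative integers, $[n]=\{1,\dots,n\}$, $\|\cdot\|_p$ is the $p$-norm and $\|\cdot\|=\|\cdot\|_2$. The graph has symmetric weighted adjacency matrix $A=(a_{ij})$, $a_{ij}\ge0$, $a_{ii}=0$; $(i,j)$ is an edge iff $a_{ij}>0$; $L=(L_{ij})=\mathrm{diag}(\sum_j a_{1j},\dots,\sum_j a_{nj})-A$. $\rho(L)$ is the spectral radius of $L$ and $\rho_2(L)$ its smallest positive eigenvalue. $\mathbf{E}_{\mathcal C}$ is expectation over the internal randomness of the compressor; each application of $\mathcal C$ uses fresh randomness, so the compressor inequality holds conditionally on the past. Algorithm 3: positive parameters $\alpha,\beta,\eta$ and a positive scaling sequence $\{s_k\}$. Initialize with arbitrary (deterministic) $x_{i,0}\in\mathbb{R}^d$, $\hat x_{i,-1}=y_{i,-1}=v_{i,0}=\mathbf 0_d$, $q_{i,0}=\mathcal C(x_{i,0}/s_0)$. For $k=0,1,\dots$ and all $i\in[n]$: $\hat x_{i,k}=\hat x_{i,k-1}+s_kq_{i,k}$; $y_{i,k}=y_{i,k-1}+s_kq_{i,k}-s_k\sum_{j=1}^nL_{ij}q_{j,k}$; $x_{i,k+1}=x_{i,k}-\eta\alpha(\hat x_{i,k}-y_{i,k})-\eta(\beta v_{i,k}+\nabla f_i(x_{i,k}))$; $v_{i,k+1}=v_{i,k}+\eta\beta(\hat x_{i,k}-y_{i,k})$; $q_{i,k+1}=\mathcal C((x_{i,k+1}-\hat x_{i,k})/s_{k+1})$. Constants: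 $\kappa_4>0$ is any constant; $\kappa_1$ is any constant with $\kappa_1\ge\max\{\frac{9+\kappa_4}{2\rho_2(L)},1\}$; $\kappa_5=\max\{\frac{4+5L_f^2}{\kappa_4},\frac{6}{\rho_2(L)}\}$; $\kappa_6=\frac{8(\kappa_1+1)^2L_f^2}{\kappa_5\rho_2(L)}+\frac{4L_f^2}{\rho_2^2(L)}$; $\kappa_2=\max\{\kappa_5,\sqrt{\kappa_6}\}$; $\tilde\kappa_3=\min\{\frac{\epsilon_1}{\tilde\epsilon_2},\frac{\epsilon_3}{\tilde\epsilon_4},\frac{\epsilon_5}{\epsilon_6}\}$, with $\epsilon_1=\frac{\alpha}{2}\rho_2(L)-\frac14(9\beta+4+5L_f^2)$, $\tilde\epsilon_2=3L_f^2+2\beta^2+1+3\alpha^2\rho^2(L)$, $\epsilon_3=\frac{\beta}{2}-3\rho_2^{-1}(L)$, $\tilde\epsilon_4=2\beta^2\rho(L)+\rho_2^{-1}(L)$, $\epsilon_5=\frac18-\frac{(\alpha+\beta)^2L_f^2}{\beta^5\rho_2(L)}-\frac{L_f^2}{2\beta^2\rho_2^2(L)}$, $\epsilon_6=\frac{(\alpha+\beta)L_f^2}{2\beta^3\rho_2(L)}+\frac{3L_f^2}{4}+\frac{L_f^2}{2\beta^2\rho_2^2(L)}+\frac{L_f}{2}$. *)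

(* Defs.v *)
(* MathComp / MathComp-Analysis *)
From HB Require Import structures.
From mathcomp Require Import all_boot all_order all_algebra.
From mathcomp Require Import all_classical all_reals all_analysis.
Set Implicit Arguments.
Unset Strict Implicit.
Unset Printing Implicit Defensive.
Import Order.TTheory GRing.Theory Num.Theory numFieldNormedType.Exports.
Local Open Scope classical_set_scope.
Local Open Scope ring_scope.

Section Euclidean.
Variables (R : realType) (d : nat).

(* The library norm on 'rV[R]_d is the sup norm, hence these two norms.  *)
Definition lpnorm (p : R) (x : 'rV[R]_d) : R :=
  (\sum_(j < d) `|x ord0 j| `^ p) `^ p^-1.

Definition norm2 (x : 'rV[R]_d) : R := Num.sqrt (\sum_(j < d) x ord0 j ^+ 2).

Definition gradient (f : 'rV[R]_d -> R) (x : 'rV[R]_d) : 'rV[R]_d :=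
  \row_(j < d) 'D_(delta_mx ord0 j) f x.

Definition is_minimum (f : 'rV[R]_d -> R) (m : R) : Prop :=
  (exists x, f x = m) /\ (forall x, m <= f x).

Definition average n (x : 'I_n -> 'rV[R]_d) : 'rV[R]_d :=
  n%:R^-1 *: \sum_(i < n) x i.

Definition mean_fun n (f : 'I_n -> 'rV[R]_d -> R) (x : 'rV[R]_d) : R :=
  n%:R^-1 * \sum_(i < n) f i x.

End Euclidean.

Section Graph.
Variables (R : realType) (n : nat).

Definition weighted_adjacency (A : 'M[R]_n) : Prop :=
  [/\ A^T = A, forall i j, 0 <= A i j & forall i, A i i = 0].

Definition connected_graph (A : 'M[R]_n) : Prop :=
  forall i j, connect (fun i j => 0 < A i j) i j.

Definition laplacian (A : 'M[R]_n) : 'M[R]_n :=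
  diag_mx (\row_i \sum_j A i j) - A.

(* Only real eigenvalues are considered: this is the usual spectral radius of
   a symmetric matrix such as a Laplacian.  The set of eigenvalues is finite,
   so that the sup below is a maximum, and the inf is a minimum whenever there
   is a positive eigenvalue. *)
Definition spectral_radius (M : 'M[R]_n) : R :=
  sup [set `|a| | a in [set a | eigenvalue M a]].

Definition least_pos_eigenvalue (M : 'M[R]_n) : R :=
  inf [set a | eigenvalue M a /\ 0 < a].

End Graph.

Section RandomCompressor.
Context {dX : measure_display} {Xi : measurableType dX} {R : realType} (d : nat).

(* A random map of R^d is a map cmp of a seed u : Xi and a point x : R^d, the
   seed being drawn from a probability on Xi; a deterministic map is one that
   ignores its seed.  R^d carries its Borel sigma-algebra, which the library
   provides on d.-tuple R only. *)
Definition random_map (cmp : Xi -> 'rV[R]_d -> 'rV[R]_d) : Prop :=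
  forall j : 'I_d, measurable_fun [set: Xi * d.-tuple R]
    (fun z => cmp z.1 (\row_(l < d) tnth z.2 l) ord0 j).

Definition bounded_compression_error (mu : probability Xi R)
    (cmp : Xi -> 'rV[R]_d -> 'rV[R]_d) (p C : R) : Prop :=
  forall x : 'rV[R]_d, ('E_mu[fun u => (lpnorm p (cmp u x - x) ^+ 2)%R] <= C%:E)%E.

End RandomCompressor.

Section FreshRandomness.
Context {dO : measure_display} {Omega : measurableType dO} {R : realType}
  (P : probability Omega R) {dX : measure_display} {Xi : measurableType dX}.

Definition mutually_independent (I : eqType) (X : I -> Omega -> Xi) : Prop :=
  forall (J : seq I) (B : I -> set Xi), uniq J -> (forall j, measurable (B j)) ->
    P (\bigcap_(j in [set` J]) X j @^-1` B j) =
    (\prod_(j <- J) P (X j @^-1` B j))%E.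

(* xi k i is the seed of the application of the compressor that produces
   q_{i,k}. *)
Definition fresh_seeds (mu : probability Xi R) n
    (xi : nat -> 'I_n -> Omega -> Xi) : Prop :=
  [/\ forall k i, measurable_fun [set: Omega] (xi k i),
      forall k i (B : set Xi), measurable B -> P (xi k i @^-1` B) = mu B &
      mutually_independent (fun ki : nat * 'I_n => xi ki.1 ki.2)].

End FreshRandomness.

(* prev u k is u_{k-1}, with the convention u_{-1} = 0. *)
Definition prev {Omega : Type} {R : realType} {d n : nat}
    (u : nat -> 'I_n -> Omega -> 'rV[R]_d) (k : nat) (i : 'I_n) (w : Omega) :
    'rV[R]_d :=
  if k is k'.+1 then u k' i w else 0.

(* For k = 0 the equation on q reads q_{i,0} = C(x_{i,0} / s_0). *)
Record algorithm3 {Omega Xi : Type} {R : realType} {d n : nat}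
    (L : 'M[R]_n) (f : 'I_n -> 'rV[R]_d -> R)
    (cmp : Xi -> 'rV[R]_d -> 'rV[R]_d) (xi : nat -> 'I_n -> Omega -> Xi)
    (alpha beta eta : R) (s : nat -> R) (x0 : 'I_n -> 'rV[R]_d)
    (x xh y v q : nat -> 'I_n -> Omega -> 'rV[R]_d) : Prop := Algorithm3 {
  alg_x0 : forall i w, x 0%N i w = x0 i;
  alg_v0 : forall i w, v 0%N i w = 0;
  alg_q : forall k i w,
    q k i w = cmp (xi k i w) ((s k)^-1 *: (x k i w - prev xh k i w));
  alg_xh : forall k i w, xh k i w = prev xh k i w + s k *: q k i w;
  alg_y : forall k i w,
    y k i w = prev y k i w + s k *: q k i w
              - s k *: \sum_(j < n) L i j *: q k j w;
  alg_x : forall k i w,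
    x k.+1 i w = x k i w - (eta * alpha) *: (xh k i w - y k i w)
                 - eta *: (beta *: v k i w + gradient (f i) (x k i w));
  alg_v : forall k i w,
    v k.+1 i w = v k i w + (eta * beta) *: (xh k i w - y k i w)
}.

Section Constants.
Variables (R : realType) (n : nat) (L : 'M[R]_n) (Lf : R).
Let rho := spectral_radius L.
Let rho2 := least_pos_eigenvalue L.

Definition kappa1_bound (kappa4 : R) : R :=
  Num.max ((9 + kappa4) / (2 * rho2)) 1.

Definition kappa5 (kappa4 : R) : R :=
  Num.max ((4 + 5 * Lf ^+ 2) / kappa4) (6 / rho2).

Definition kappa6 (kappa1 kappa4 : R) : R :=
  8 * (kappa1 + 1) ^+ 2 * Lf ^+ 2 / (kappa5 kappa4 * rho2)
  + 4 * Lf ^+ 2 / rho2 ^+ 2.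

Definition kappa2 (kappa1 kappa4 : R) : R :=
  Num.max (kappa5 kappa4) (Num.sqrt (kappa6 kappa1 kappa4)).

Definition eps1 (alpha beta : R) : R :=
  alpha / 2 * rho2 - 1 / 4 * (9 * beta + 4 + 5 * Lf ^+ 2).

Definition teps2 (alpha beta : R) : R :=
  3 * Lf ^+ 2 + 2 * beta ^+ 2 + 1 + 3 * alpha ^+ 2 * rho ^+ 2.

Definition eps3 (beta : R) : R := beta / 2 - 3 * rho2^-1.

Definition teps4 (beta : R) : R := 2 * beta ^+ 2 * rho + rho2^-1.

Definition eps5 (alpha beta : R) : R :=
  1 / 8 - (alpha + beta) ^+ 2 * Lf ^+ 2 / (beta ^+ 5 * rho2)
  - Lf ^+ 2 / (2 * beta ^+ 2 * rho2 ^+ 2).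

Definition eps6 (alpha beta : R) : R :=
  (alpha + beta) * Lf ^+ 2 / (2 * beta ^+ 3 * rho2) + 3 * Lf ^+ 2 / 4
  + Lf ^+ 2 / (2 * beta ^+ 2 * rho2 ^+ 2) + Lf / 2.

Definition tkappa3 (alpha beta : R) : R :=
  Num.min (eps1 alpha beta / teps2 alpha beta)
    (Num.min (eps3 beta / teps4 beta) (eps5 alpha beta / eps6 alpha beta)).

End Constants.

(* u_T = O(1), with a bound uniform in all T. *)
Definition bigO1 {R : realType} (u : nat -> \bar R) : Prop :=
  exists M : R, forall T : nat, (`|u T| <= M%:E)%E.

(* Main.v *)
(* Write [e = xh - x]. Since [xh_k = xh_(k-1) + s_k q_k], the error [e_k] is
   [s_k] times the compression error of a vector that only depends on the seeds
   of the previous iterations; freshness of the seeds and Tonelli's theorem give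
   [E |e_k|^2 <= d C s_k^2] in each agent, which is summable in [k].

   On the other hand [y = xh - L xh], so that the algorithm is a primal-dual
   gradient method perturbed by [e]. Let [K] be the centering projection, [Q] the
   pseudo-inverse of [L] and [u = K (v + g / beta)], where [g] collects the
   gradients of the [f_i] at the average iterate [xbar]. Along every trajectory
     [|K x|^2 / 2 + (alpha + beta) / (2 beta) <u, Q u> + <K x, Q u> + sum_i f_i(xbar)]
   decreases at each iteration by at least a fixed positive multiple of
   [sum_i |x_i - xbar|^2 + n |grad f(xbar)|^2], up to a constant times [|e|^2],
   and it dominates [n f(xbar)]. Summing over the iterations and taking
   expectations gives both bounds. *)
Require Import Defs.
From HB Require Import structures.
From mathcomp Require Import all_boot all_order all_algebra.
From mathcomp Require Import all_classical all_reals all_analysis.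
From mathcomp Require Import measurable_realfun ring lra.
Import Order.TTheory GRing.Theory Num.Theory numFieldNormedType.Exports.
Set Implicit Arguments.
Unset Strict Implicit.
Unset Printing Implicit Defensive.
Local Open Scope classical_set_scope.
Local Open Scope ring_scope.

(** * The Frobenius inner product and extremal eigenvalues of symmetric matrices *)

(** At consensus, stationarity forces [beta v = - K g], a target that moves with the average
    iterate: this is why [u] is the dual error, and why each step adds a drift term. The drift is of
    size [eta |gbar|], [gbar] being the average of the local gradients. It is paid for by
    polarization of [- eta <grad f, gbar>], which yields [- eta / 2 (|grad f|^2 + |gbar|^2)] up to
    the disagreement.

    The squared terms alone give no decay of [u]. The cross term [<K x, Q u>] does: it contributes
    [- eta beta <u, Q u>], at the price of [eta beta |K x|^2], which the consensus decay of rate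
    [alpha rho2 / 2] absorbs since [alpha] is a large enough multiple of [beta].

    The constants are budgets. The pairs ([eps1], [teps2]), ([eps3], [teps4]) and ([eps5], [eps6])
    hold the terms of order [eta] and [eta^2] multiplying [|K x|^2], [<u, Q u>] and [n |gbar|^2].

    The descent holds pathwise and everything integrated is nonnegative, so integrability is never
    an issue. Randomness enters only in the noise bound, where a product measure takes the place of
    conditional expectation. *)

Definition mdot {R : realType} {m n : nat} (X Y : 'M[R]_(m, n)) : R := \tr (X^T *m Y).

Section Dot.
Variables (R : realType) (m n : nat).
Implicit Types X Y Z : 'M[R]_(m, n).

Lemma mdotE X Y : mdot X Y = \sum_i \sum_j X i j * Y i j.
Proof.
rewrite /mdot /mxtrace exchange_big; apply: eq_bigr => j _.
by rewrite mxE; apply: eq_bigr => i _; rewrite mxE.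
Qed.

Lemma mdotC X Y : mdot X Y = mdot Y X.
Proof. by rewrite /mdot -mxtrace_tr trmx_mul trmxK. Qed.

Lemma mdotDr X Y Z : mdot X (Y + Z) = mdot X Y + mdot X Z.
Proof. by rewrite /mdot mulmxDr mxtraceD. Qed.

Lemma mdotZr a X Y : mdot X (a *: Y) = a * mdot X Y.
Proof. by rewrite /mdot -scalemxAr mxtraceZ. Qed.

Lemma mdotNr X Y : mdot X (- Y) = - mdot X Y.
Proof. by rewrite -scaleN1r mdotZr mulN1r. Qed.

Lemma mdotDl X Y Z : mdot (X + Y) Z = mdot X Z + mdot Y Z.
Proof. by rewrite mdotC mdotDr !(mdotC Z). Qed.

Lemma mdotZl a X Y : mdot (a *: X) Y = a * mdot X Y.
Proof. by rewrite mdotC mdotZr (mdotC Y). Qed.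

Lemma mdotNl X Y : mdot (- X) Y = - mdot X Y.
Proof. by rewrite mdotC mdotNr (mdotC Y). Qed.

Lemma mdot0r X : mdot X 0 = 0.
Proof. by rewrite /mdot mulmx0 mxtrace0. Qed.

Lemma mdot_ge0 X : 0 <= mdot X X.
Proof. by rewrite mdotE; do 2 apply: sumr_ge0 => ? _; rewrite -expr2 sqr_ge0. Qed.

Lemma mdot_eq0 X : (mdot X X == 0) = (X == 0).
Proof.
apply/eqP/eqP => [|->]; last by rewrite mdot0r.
rewrite mdotE => /psumr_eq0P X0; apply/matrixP => i j; rewrite mxE.
have {}X0 : forall i, true -> \sum_j X i j * X i j = 0.
  by apply: X0 => k _; apply: sumr_ge0 => l _; rewrite -expr2 sqr_ge0.
have /psumr_eq0P X0i := X0 i isT.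
by apply/eqP; rewrite -sqrf_eq0 expr2 X0i// => k _; rewrite -expr2 sqr_ge0.
Qed.

Lemma mdot_gt0 X : (0 < mdot X X) = (X != 0).
Proof. by rewrite lt_neqAle mdot_ge0 andbT eq_sym mdot_eq0. Qed.

Lemma mdot_young a X Y : 0 < a ->
  mdot X Y <= a / 2 * mdot X X + (2 * a)^-1 * mdot Y Y.
Proof.
move=> a0; have := mdot_ge0 (a *: X - Y).
rewrite !(mdotDl, mdotDr, mdotNl, mdotNr, mdotZl, mdotZr) (mdotC Y X) => h.
rewrite -subr_ge0.
have -> : a / 2 * mdot X X + (2 * a)^-1 * mdot Y Y - mdot X Y =
  (2 * a)^-1 * (a * (a * mdot X X) + - (a * mdot X Y) +
     (- (a * mdot X Y) + - - mdot Y Y)) by field; rewrite gt_eqF.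
apply: mulr_ge0; first by rewrite invr_ge0 mulr_ge0// ltW.
lra.
Qed.

Lemma mdot_youngN a X Y : 0 < a ->
  - mdot X Y <= a / 2 * mdot X X + (2 * a)^-1 * mdot Y Y.
Proof.
by move=> a0; have := mdot_young X (- Y) a0; rewrite !mdotNr mdotNl opprK.
Qed.

(** Young's inequality with the discriminant condition left as a side condition: choosing weights
    then amounts to checking one inequality, and the absolute value serves both signs. *)
Lemma mdot_norm_le a b X Y : 0 < a -> 1 <= 4 * a * b ->
  `|mdot X Y| <= a * mdot X X + b * mdot Y Y.
Proof.
move=> a0 ab; have a20 : 0 < 2 * a by rewrite mulr_gt0.
have hb : (2 * (2 * a))^-1 * mdot Y Y <= b * mdot Y Y.
  rewrite ler_wpM2r ?mdot_ge0// -[leLHS]mulr1 ler_pdivrMl ?mulr_gt0//.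
  by rewrite mulrA -natrM.
have := mdot_youngN X Y a20; have := mdot_young X Y a20.
rewrite (_ : 2 * a / 2 = a); last by field.
by move=> h1 h2; rewrite ler_norml lerNl (le_trans h2) ?(le_trans h1)// lerD2l.
Qed.

Lemma mdot_sqrD_le a X Y : 0 < a ->
  mdot (X + Y) (X + Y) <= (1 + a) * mdot X X + (1 + a^-1) * mdot Y Y.
Proof.
move=> a0; have := mdot_young X Y a0.
rewrite !(mdotDl, mdotDr) (mdotC Y X) invfM.
set u := mdot X Y; set v := mdot X X; set w := mdot Y Y; lra.
Qed.

Lemma mdot_mulmx (S : 'M[R]_m) X Y : mdot (S *m X) Y = mdot X (S^T *m Y).
Proof. by rewrite /mdot trmx_mul mulmxA. Qed.

Lemma mdot_mulmxr X Y (S : 'M[R]_n) : mdot (X *m S) Y = mdot X (Y *m S^T).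
Proof. by rewrite /mdot trmx_mul -mulmxA mxtrace_mulC mulmxA. Qed.

Lemma mdot_sqrD3_le a b X Y Z :
  mdot (a *: X + b *: Y + Z) (a *: X + b *: Y + Z) <=
  3 * (a ^+ 2 * mdot X X + b ^+ 2 * mdot Y Y + mdot Z Z).
Proof.
have := @mdot_sqrD_le 2^-1 (a *: X + b *: Y) Z; rewrite invr_gt0 ltr0n => /(_ isT).
have := @mdot_sqrD_le 1 (a *: X) (b *: Y) (@ltr01 R).
rewrite invrK invr1 !(mdotZl, mdotZr) !expr2; lra.
Qed.

End Dot.

Lemma mdot_rows (R : realType) m n (X Y : 'M[R]_(m, n)) : mdot X Y = \sum_i mdot (row i X) (row i Y).
Proof.
rewrite mdotE; apply: eq_bigr => i _; rewrite mdotE big_ord1.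
by apply: eq_bigr => j _; rewrite !mxE.
Qed.

Lemma mdot_tr (R : realType) m n (X Y : 'M[R]_(m, n)) : mdot X^T Y^T = mdot X Y.
Proof. by rewrite /mdot trmxK mxtrace_mulC -mxtrace_tr trmx_mul trmxK. Qed.

Lemma norm2_sqr (R : realType) d (x : 'rV[R]_d) : norm2 x ^+ 2 = mdot x x.
Proof.
rewrite /norm2 sqr_sqrtr; last by apply: sumr_ge0 => *; rewrite sqr_ge0.
by rewrite mdotE big_ord1; apply: eq_bigr => j _; rewrite expr2.
Qed.

(** A quadratic form on matrices splits over columns, which carries the spectral bounds for row
    vectors over to all coordinates of the agents at once. *)
Lemma mdot_mulmx_cols (R : realType) m n (S : 'M[R]_m) (X : 'M[R]_(m, n)) :
  mdot X (S *m X) = \sum_j mdot (row j X^T) (row j X^T *m S^T).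
Proof.
rewrite -mdot_tr mdot_rows; apply: eq_bigr => j _.
by rewrite -row_mul trmx_mul.
Qed.

Section Rayleigh.
Variables (R : realType) (n : nat).
Implicit Types (S : 'M[R]_n) (x w : 'rV[R]_n).

Lemma quad_continuous S : continuous (fun x : 'rV[R]_n => mdot x (x *m S)).
Proof.
have -> : (fun x => mdot x (x *m S)) =
    (fun x => \sum_j x ord0 j * \sum_k x ord0 k * S k j).
  apply/funext => x; rewrite mdotE big_ord1.
  by apply: eq_bigr => j _; rewrite mxE.
apply: continuous_big => [|j _ x]; first exact: add_continuous.
apply: continuousM; first exact: (@coord_continuous R).
apply: continuous_big => [|k _ y]; first exact: add_continuous.
by apply: continuousM; [exact: (@coord_continuous R)|exact: cst_continuous].
Qed.

(** The quadratic form attains its minimum on the unit sphere by compactness, and a minimizer is an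
    eigenvector. Applied to [L + J], [L + t J] and [- L], this supplies every spectral fact about
    the Laplacian. *)
Lemma min_rayleigh_eigen S : (0 < n)%N -> S^T = S ->
  exists2 a, eigenvalue S a & forall x, a * mdot x x <= mdot x (x *m S).
Proof.
move=> n0 SS; pose B := [set x : 'rV[R]_n | mdot x x = 1].
have cB : compact B.
  apply: bounded_closed_compact.
    exists 1; split=> // M M1 x Bx; apply: (le_trans _ (ltW M1)).
    rewrite /Num.norm/= mx_normrE; apply: bigmax_le => // -[i j] _ /=.
    rewrite ord1 -(@expr_le1 _ 2)// real_normK ?num_real//.
    rewrite -Bx mdotE big_ord1 (bigD1 j)//= expr2 lerDl.
    by apply: sumr_ge0 => k _; rewrite -expr2 sqr_ge0.
  rewrite (_ : B = (fun x => mdot x (x *m 1%:M)) @^-1` [set 1]); last first.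
    by apply/seteqP; split=> x; rewrite /B/= mulmx1.
  apply: closed_comp; last exact: closed_eq.
  by move=> x _; apply: quad_continuous.
have B0 : B !=set0.
  exists (delta_mx ord0 (Ordinal n0)); rewrite /B/= mdotE big_ord1.
  rewrite (bigD1 (Ordinal n0))//= !mxE !eqxx mulr1 big1 ?addr0// => j /negPf jn.
  by rewrite !mxE jn andbF mul0r.
have [|w /set_mem Bw wmin] := EVT_min_rV (f := fun x => mdot x (x *m S)) B0 cB.
  by apply: continuous_subspaceT; exact: quad_continuous.
set a := mdot w (w *m S).
have aP x : a * mdot x x <= mdot x (x *m S).
  have [->|x0] := eqVneq x 0; first by rewrite mul0mx !mdot0r mulr0.
  have d0 : 0 < mdot x x by rewrite mdot_gt0.
  pose c := (Num.sqrt (mdot x x))^-1.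
  have c2 : c * c = (mdot x x)^-1.
    by rewrite -expr2 exprVn sqr_sqrtr// ltW.
  have := wmin (c *: x); rewrite -scalemxAl !(mdotZl, mdotZr) !mulrA c2.
  rewrite ler_pdivlMl ?mulr_gt0// ?(mulrC (mdot x x)); apply.
  by apply/mem_set; rewrite /B/= !(mdotZl, mdotZr) mulrA c2 mulVf ?gt_eqF.
exists a => //; apply/eigenvalueP; exists w; last first.
  by rewrite -mdot_gt0 Bw.
(* First-order optimality of [w] for [x |-> mdot x (x *m S) - a * mdot x x], tested in the direction of its gradient. *)
have [z zE] : exists z, z = w *m S - a *: w by eexists.
apply/eqP; rewrite -subr_eq0 -zE -mdot_eq0 eq_le mdot_ge0 andbT leNgt.
apply/negP => z0.
have symS x y : mdot x (y *m S) = mdot y (x *m S).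
  by rewrite mdotC mdot_mulmxr SS.
pose b := mdot z (z *m S) - a * mdot z z.
have key t : 0 <= - 2 * t * mdot z z + t ^+ 2 * b.
  have := aP (w - t *: z); rewrite -subr_ge0.
  rewrite mulmxBl -scalemxAl !(mdotDl, mdotDr, mdotNl, mdotNr, mdotZl, mdotZr).
  rewrite (symS w z) -/a (mdotC w z).
  have -> : mdot z (w *m S) = mdot z z + a * mdot z w.
    by rewrite -mdotZr -mdotDr {3}zE subrK.
  rewrite Bw /b; lra.
(* The step is short enough for [t * b] to stay below [|z|^2], so the linear decrease [- 2 t |z|^2]
   wins and contradicts minimality; the [+ 1] keeps the denominator positive. *)
have := key (mdot z z / (`|b| + 1)).
have b1 : 0 < `|b| + 1 by rewrite ltr_wpDl.
set t := _ / _.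
have t0 : 0 < t by rewrite divr_gt0.
have tb : t * b <= mdot z z.
  rewrite /t mulrAC ler_pdivrMr// ler_pM2l// (le_trans (ler_norm b))//.
  by rewrite lerDl.
have -> : - 2 * t * mdot z z + t ^+ 2 * b = t * (t * b - 2 * mdot z z) by ring.
rewrite pmulr_rge0//; lra.
Qed.

End Rayleigh.

(** * Spectral bounds for the Laplacian of a connected graph *)

Section Averaging.
Variables (R : realType) (n : nat).
Hypothesis n_gt0 : (0 < n)%N.

Definition avg_mx : 'M[R]_n := const_mx n%:R^-1.
Definition cent_mx : 'M[R]_n := 1%:M - avg_mx.

Lemma avg_mx_tr : avg_mx^T = avg_mx.
Proof. exact: trmx_const. Qed.

Lemma cent_mx_tr : cent_mx^T = cent_mx.
Proof. by rewrite /cent_mx linearB/= trmx1 avg_mx_tr. Qed.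

Lemma avg_mx_idem : avg_mx *m avg_mx = avg_mx.
Proof.
apply/matrixP => i j; rewrite !mxE.
under eq_bigr do rewrite !mxE.
rewrite sumr_const card_ord -[(_ * _) *+ n]mulr_natr -mulrA mulVf ?mulr1//.
by rewrite pnatr_eq0 -lt0n.
Qed.

Lemma cent_mx_avg : cent_mx *m avg_mx = 0.
Proof. by rewrite /cent_mx mulmxBl mul1mx avg_mx_idem subrr. Qed.

Lemma avg_mx_cent : avg_mx *m cent_mx = 0.
Proof. by rewrite /cent_mx mulmxBr mulmx1 avg_mx_idem subrr. Qed.

Lemma cent_mx_idem : cent_mx *m cent_mx = cent_mx.
Proof. by rewrite {2}/cent_mx mulmxBr mulmx1 cent_mx_avg subr0. Qed.

Lemma row_avg_mx d (X : 'M[R]_(n, d)) i :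
  row i (avg_mx *m X) = average (fun i => row i X).
Proof.
apply/rowP => j; rewrite [LHS]mxE [LHS]mxE [RHS]mxE summxE mulr_sumr.
by apply: eq_bigr => k _; rewrite !mxE.
Qed.

Lemma row_cent_mx d (X : 'M[R]_(n, d)) i :
  row i (cent_mx *m X) = row i X - average (fun i => row i X).
Proof. by rewrite /cent_mx mulmxBl mul1mx linearB/= row_avg_mx. Qed.

Lemma mdot_cent_avg d (X : 'M[R]_(n, d)) : mdot X X =
  mdot (cent_mx *m X) (cent_mx *m X) + mdot (avg_mx *m X) (avg_mx *m X).
Proof.
have hX : X = cent_mx *m X + avg_mx *m X by rewrite -mulmxDl subrK mul1mx.
have h0 : mdot (cent_mx *m X) (avg_mx *m X) = 0.
  by rewrite mdot_mulmx cent_mx_tr mulmxA cent_mx_avg mul0mx mdot0r.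
by rewrite {1 2}hX mdotDl !mdotDr h0 (mdotC (avg_mx *m X)) h0 addr0 add0r.
Qed.

Lemma mdot_cent_le d (X : 'M[R]_(n, d)) :
  mdot (cent_mx *m X) (cent_mx *m X) <= mdot X X.
Proof. by rewrite [leRHS]mdot_cent_avg lerDl mdot_ge0. Qed.

Lemma mdot_avg_le d (X : 'M[R]_(n, d)) :
  mdot (avg_mx *m X) (avg_mx *m X) <= mdot X X.
Proof. by rewrite [leRHS]mdot_cent_avg lerDr mdot_ge0. Qed.

End Averaging.

Section Laplacian.
Variables (R : realType) (n : nat).
Variable A : 'M[R]_n.
Hypotheses (n_ge2 : (2 <= n)%N) (hA : weighted_adjacency A)
  (hconn : connected_graph A).
Let n_gt0 : (0 < n)%N := ltnW n_ge2.
Let L := laplacian A.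
Let rho := spectral_radius L.
Let rho2 := least_pos_eigenvalue L.
Let J := avg_mx R n.
Let K := cent_mx R n.

Lemma laplacian_tr : L^T = L.
Proof. by have [AA _ _] := hA; rewrite /L/laplacian linearB/= tr_diag_mx AA. Qed.

Lemma laplacian_avg : L *m J = 0.
Proof.
apply/matrixP => i j; rewrite !mxE.
under eq_bigr do rewrite !mxE.
rewrite -mulr_suml sumrB (bigD1 i)//= eqxx mulr1n [X in _ + X - _]big1.
  by rewrite addr0 subrr mul0r.
by move=> k /negPf ki; rewrite eq_sym ki mulr0n.
Qed.

Lemma avg_laplacian : J *m L = 0.
Proof. by rewrite -[J]trmxK -[L]trmxK -trmx_mul laplacian_tr avg_mx_tr laplacian_avg trmx0. Qed.

Lemma laplacian_quad (x : 'rV[R]_n) : mdot x (x *m L) =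
  2^-1 * \sum_i \sum_j A i j * (x ord0 i - x ord0 j) ^+ 2.
Proof.
have [AA _ _] := hA.
pose s := \sum_i \sum_j A i j * x ord0 i ^+ 2.
pose t := \sum_i \sum_j A i j * (x ord0 i * x ord0 j).
have -> : mdot x (x *m L) = s - t.
  rewrite mdotE big_ord1 /s /t -sumrB; apply: eq_bigr => i _.
  rewrite mxE; under eq_bigr do rewrite !mxE mulrBr.
  rewrite sumrB (bigD1 i)//= eqxx [X in _ + X - _]big1; last first.
    by move=> k /negPf ki; rewrite ki mulr0n mulr0.
  rewrite addr0 mulr1n mulrBr; congr (_ - _); first by rewrite -mulr_suml; ring.
  rewrite mulr_sumr; apply: eq_bigr => j _; rewrite -[in LHS]AA mxE; ring.
have s' : s = \sum_i \sum_j A i j * x ord0 j ^+ 2.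
  rewrite exchange_big/=; apply: eq_bigr => i _; apply: eq_bigr => j _.
  by rewrite -[in LHS]AA mxE.
have -> : \sum_i \sum_j A i j * (x ord0 i - x ord0 j) ^+ 2 = s + s - 2 * t.
  rewrite {2}s' /s /t mulr_sumr -big_split -sumrB/=; apply: eq_bigr => i _.
  rewrite mulr_sumr -big_split -sumrB/=; apply: eq_bigr => j _; ring.
by field.
Qed.

Lemma laplacian_psd (x : 'rV[R]_n) : 0 <= mdot x (x *m L).
Proof.
have [_ A0 _] := hA; rewrite laplacian_quad mulr_ge0 ?invr_ge0//.
by do 2 apply: sumr_ge0 => ? _; rewrite mulr_ge0 ?sqr_ge0.
Qed.

(** Each term of the Dirichlet form vanishes, so entries agree across edges, hence along paths, and
    connectedness makes the vector constant; a constant vector of mean zero is zero. *)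
Lemma laplacian_ker (x : 'rV[R]_n) : mdot x (x *m L) <= 0 -> x *m J = 0 -> x = 0.
Proof.
have [_ A0 _] := hA.
move=> x0 xJ; have {x0} x0 : mdot x (x *m L) == 0 by rewrite eq_le x0 laplacian_psd.
have {x0} xA i j : A i j * (x ord0 i - x ord0 j) ^+ 2 = 0.
  move: x0; rewrite laplacian_quad mulf_eq0 invr_eq0 pnatr_eq0/=.
  have nn k l : 0 <= A k l * (x ord0 k - x ord0 l) ^+ 2 by rewrite mulr_ge0 ?sqr_ge0.
  rewrite psumr_eq0 => [|k _]; last exact: sumr_ge0.
  move=> /allP/(_ i); rewrite mem_index_enum => /(_ isT).
  rewrite psumr_eq0 => [|k _]; last exact: nn.
  by move=> /allP/(_ j); rewrite mem_index_enum => /(_ isT) /eqP.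
have xc i j : x ord0 i = x ord0 j.
  have /connectP[p] := hconn i j.
  elim: p i => [i _ -> //|k p IH i /= /andP[Aik pk] jl].
  rewrite -(IH k pk jl); apply/eqP; rewrite -subr_eq0 -sqrf_eq0.
  by have /eqP := xA i k; rewrite mulf_eq0 gt_eqF.
apply/rowP => j; rewrite mxE.
have /rowP/(_ j) := xJ; rewrite !mxE.
under eq_bigr do rewrite mxE (xc _ j).
rewrite -mulr_suml sumr_const card_ord -[x _ _ *+ n]mulr_natr -mulrA divff ?mulr1//.
by rewrite pnatr_eq0 -lt0n.
Qed.

Lemma eigen_avg (x : 'rV[R]_n) a : x *m L = a *: x -> a != 0 -> x *m J = 0.
Proof.
move=> xL a0; apply/eqP; have : a *: (x *m J) == 0.
  by rewrite scalemxAl -xL -mulmxA laplacian_avg mulmx0.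
by rewrite scaler_eq0 (negPf a0).
Qed.

Lemma avg_psd (x : 'rV[R]_n) : 0 <= mdot x (x *m J).
Proof.
have -> : x *m J = x *m J *m J by rewrite -mulmxA avg_mx_idem.
by rewrite mdotC mdot_mulmxr avg_mx_tr mdot_ge0.
Qed.

(** Adding [J] lifts the kernel of [L], which consists of the constants. The resulting coercivity
    bounds all positive eigenvalues away from 0 and makes [L + J] invertible. *)
Lemma laplacian_avg_posdef : exists2 a, 0 < a &
  forall x : 'rV[R]_n, a * mdot x x <= mdot x (x *m (L + J)).
Proof.
have [|a /eigenvalueP[w wa w0] aP] := @min_rayleigh_eigen R n (L + J) n_gt0.
  by rewrite linearD/= laplacian_tr avg_mx_tr.
exists a => //; rewrite ltNge; apply/negP => a0.
have h : mdot w (w *m L) + mdot w (w *m J) <= 0.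
  by rewrite -mdotDr -mulmxDr wa mdotZr mulr_le0_ge0// mdot_ge0.
have h1 := laplacian_psd w; have h2 := avg_psd w.
move/eqP: w0; apply; apply: laplacian_ker; first lra.
apply/eqP; rewrite -mdot_eq0 mdot_mulmxr avg_mx_tr -mulmxA avg_mx_idem//.
rewrite eq_le h2 andbT; lra.
Qed.

(** The infimum defining [rho2] is informative only over a nonempty set. Two distinct vertices give
    a nonzero centered vector [x], where the form is positive, so the largest eigenvalue of [L] is
    positive. *)
Lemma pos_eigenvalues_nonempty : [set a | eigenvalue L a /\ 0 < a] !=set0.
Proof.
have [|a /eigenvalueP[w wa w0] aP] := @min_rayleigh_eigen R n (- L) n_gt0.
  by rewrite linearN/= laplacian_tr.
pose i0 : 'I_n := Ordinal n_gt0; pose i1 : 'I_n := Ordinal n_ge2.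
pose x : 'rV[R]_n := delta_mx ord0 i0 - delta_mx ord0 i1.
have xx : 0 < mdot x x.
  rewrite mdot_gt0; apply/eqP => /rowP/(_ i0); rewrite !mxE !eqxx/=.
  by rewrite subr0 => /eqP; rewrite oner_eq0.
have a0 : a < 0.
  have := aP x; rewrite mulmxN mdotNr => h.
  rewrite ltNge; apply/negP => a0.
  have h' : mdot x (x *m L) <= 0.
    by rewrite -oppr_ge0; apply: le_trans h; rewrite mulr_ge0// ltW.
  suff x0 : x = 0 by move: xx; rewrite x0 mdot0r ltxx.
  apply: laplacian_ker => //; apply/rowP => j.
  rewrite /x mulmxBl -!rowE !mxE subrr//.
exists (- a); split; last by rewrite oppr_gt0.
apply/eigenvalueP; exists w => //.
by rewrite scaleNr -wa mulmxN opprK.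
Qed.

Lemma least_pos_eigenvalue_gt0 : 0 < rho2.
Proof.
have [a a0 aP] := laplacian_avg_posdef.
apply: (lt_le_trans a0); apply: lb_le_inf; first exact: pos_eigenvalues_nonempty.
move=> b [/eigenvalueP[w wb w0] b0].
have := aP w; rewrite mulmxDr mdotDr (eigen_avg wb) ?gt_eqF// mdot0r addr0 wb mdotZr.
by rewrite ler_pM2r// mdot_gt0.
Qed.

Lemma least_pos_eigenvalue_le a : eigenvalue L a -> 0 < a -> rho2 <= a.
Proof. by move=> ea a0; apply: ge_inf => //; exists 0 => b [_ /ltW]. Qed.

Lemma laplacian_gap_row (x : 'rV[R]_n) : x *m J = 0 ->
  rho2 * mdot x x <= mdot x (x *m L).
Proof.
(* The constants have eigenvalue [t > rho2] for [L + t J]. An eigenvector for a smaller eigenvalue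
   is therefore centered, hence an eigenvector of [L]. *)
move=> xJ; pose t := rho2 + 1.
have [|a /eigenvalueP[w wa w0] aP] := @min_rayleigh_eigen R n (L + t *: J) n_gt0.
  by rewrite linearD/= linearZ/= laplacian_tr avg_mx_tr.
have := aP x; rewrite mulmxDr -scalemxAr xJ scaler0 addr0.
apply: le_trans; rewrite ler_wpM2r ?mdot_ge0// leNgt; apply/negP => ar.
have wJ : w *m J = 0.
  have /(congr1 (mulmx^~ J)) := wa.
  rewrite -mulmxA mulmxDl laplacian_avg -scalemxAl avg_mx_idem// add0r -scalemxAr.
  rewrite -scalemxAl => /eqP; rewrite -subr_eq0 -scalerBl scaler_eq0 => /orP[|/eqP//].
  by rewrite subr_eq0 => /eqP ta; move: ar; rewrite -ta ltNge lerDl (@ler01 R).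
move: wa; rewrite mulmxDr -scalemxAr wJ scaler0 addr0 => wa.
have [a0|a0] := ltP 0 a.
  have : rho2 <= a by apply: least_pos_eigenvalue_le => //; apply/eigenvalueP; exists w.
  by rewrite leNgt ar.
move/eqP: w0; apply; apply: laplacian_ker => //.
by rewrite wa mdotZr mulr_le0_ge0// mdot_ge0.
Qed.

Lemma laplacian_radius_row (x : 'rV[R]_n) : mdot x (x *m L) <= rho * mdot x x.
Proof.
have [|a /eigenvalueP[w wa w0] aP] := @min_rayleigh_eigen R n (- L) n_gt0.
  by rewrite linearN/= laplacian_tr.
have {}wa : w *m L = - a *: w by rewrite scaleNr -wa mulmxN opprK.
have {}aP (y : 'rV_n) : mdot y (y *m L) <= - a * mdot y y.
  by rewrite mulNr lerNr -mdotNr -mulmxN.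
apply: (le_trans (aP x)); rewrite ler_wpM2r ?mdot_ge0//.
apply: (le_trans (ler_norm _)); apply: ub_le_sup; last first.
  by exists (- a) => //; apply/eigenvalueP; exists w.
(* The supremum requires the moduli of the eigenvalues to be bounded: eigenvalues are nonnegative,
   and [- a] dominates them all. *)
exists (- a) => _ [b /eigenvalueP[z zb z0] <-].
have := aP z; have := laplacian_psd z.
rewrite zb mdotZr pmulr_lge0 ?mdot_gt0// => b0.
by rewrite ger0_norm// ler_pM2r// mdot_gt0.
Qed.

Lemma least_pos_eigenvalue_le_radius : rho2 <= rho.
Proof.
have [a [/eigenvalueP[w wa w0] a0]] := pos_eigenvalues_nonempty.
apply: (@le_trans _ _ a); first by apply: least_pos_eigenvalue_le => //; apply/eigenvalueP; exists w.
by have := laplacian_radius_row w; rewrite wa mdotZr ler_pM2r// mdot_gt0.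
Qed.

Lemma laplacian_gap d (X : 'M[R]_(n, d)) : K *m X = X ->
  rho2 * mdot X X <= mdot X (L *m X).
Proof.
move=> KX; rewrite mdot_mulmx_cols -mdot_tr mdot_rows mulr_sumr laplacian_tr.
apply: ler_sum => j _; apply: laplacian_gap_row.
rewrite -row_mul -[J]avg_mx_tr -trmx_mul -KX mulmxA avg_mx_cent//.
by rewrite mul0mx trmx0 row0.
Qed.

Lemma laplacian_radius d (X : 'M[R]_(n, d)) : mdot X (L *m X) <= rho * mdot X X.
Proof.
rewrite mdot_mulmx_cols -mdot_tr mdot_rows mulr_sumr laplacian_tr.
by apply: ler_sum => j _; exact: laplacian_radius_row.
Qed.

Lemma laplacian_mx_psd d (X : 'M[R]_(n, d)) : 0 <= mdot X (L *m X).
Proof.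
rewrite mdot_mulmx_cols laplacian_tr.
by apply: sumr_ge0 => j _; exact: laplacian_psd.
Qed.

(** [(L + J)^-1] inverts [L] on centered vectors and fixes constants; subtracting [J] sends the
    constants to 0. *)
Lemma laplacian_pinv : exists Q : 'M[R]_n,
  [/\ Q^T = Q, L *m Q = K, Q *m L = K & Q *m K = Q].
Proof.
have [a a0 aP] := laplacian_avg_posdef; pose M := L + J.
have Mu : M \in unitmx.
  rewrite -row_free_unit; apply: inj_row_free => v vM.
  have := aP v; rewrite vM mdot0r pmulr_rle0// => vv.
  by apply/eqP; rewrite -mdot_eq0 eq_le vv mdot_ge0.
have MJ : M *m J = J by rewrite mulmxDl laplacian_avg avg_mx_idem// add0r.
have VJ : invmx M *m J = J by rewrite -{1}MJ mulKmx.
have VT : (invmx M)^T = invmx M.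
  by rewrite trmx_inv linearD/= laplacian_tr avg_mx_tr.
have QT : (invmx M - J)^T = invmx M - J by rewrite linearB/= VT avg_mx_tr.
have QL : (invmx M - J) *m L = K.
  rewrite mulmxBl avg_laplacian subr0 (_ : L = M - J); last by rewrite addrK.
  by rewrite mulmxBr VJ mulVmx.
exists (invmx M - J); split => //.
  by rewrite -[LHS]trmxK trmx_mul QT laplacian_tr QL cent_mx_tr.
rewrite mulmxBl avg_mx_cent// subr0.
by rewrite mulmxBr mulmx1 VJ.
Qed.

End Laplacian.

(** * One step of the Lyapunov function *)

(** The scalar half of [lyap_descent], with inner products replaced by real variables: [X], [E],
    [A], [H] are the squared norms of [p], [e], [a = p + e], [h], and [U] is [<u, Q u>]. A name such
    as [uQd] reads [<u, Q dl>]. The premises are the Young estimates of the individual terms of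
    [lyap_step]. *)
Lemma descent_arith (R : realType) (rho rho2 c k1 eta alpha beta Lf g K4 K7 K8 : R)
    (W X E A U H pLp pLe ue ph pe hu uQd pQd ww aLa ad dQd ua ha hQd : R) :
  0 <= rho -> 0 <= c -> 0 <= k1 -> 0 <= eta -> 0 <= alpha -> 0 <= beta ->
  alpha = k1 * beta -> c = k1 + 1 ->
  0 <= X -> 0 <= U -> 0 <= aLa ->
  rho2 * X <= pLp -> aLa <= rho * A -> A <= 4 / 3 * X + 4 * E -> H <= Lf ^+ 2 * X ->
  - pLe <= 2^-1 * pLp + rho / 2 * E ->
  ue <= 8^-1 * U + 2 * rho * E ->
  - ph <= 2^-1 * X + 2^-1 * H ->
  pe <= 4^-1 * X + 1 * E ->
  - hu <= 12^-1 * H + 3 * (rho2^-1 * U) ->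
  c * uQd <= eta * beta / 4 * U + eta * K7 * g ->
  pQd <= eta / 2 * X + eta * K8 / 2 * g ->
  ww <= 3 * (alpha ^+ 2 * rho ^+ 2 * A + beta ^+ 2 * rho * U + H) ->
  c * eta * beta * ad <= eta ^+ 2 * (c ^+ 2 * A + g / 4) ->
  c / 2 * dQd <= eta ^+ 2 * (K4 / 2) * g ->
  - ua <= 4^-1 * rho * U + 1 * A ->
  - (beta * ha) <= 2^-1 * H + 2^-1 * beta ^+ 2 * A ->
  - (eta * alpha * ad) <= eta ^+ 2 * (k1 ^+ 2 * A + g / 4) ->
  - (eta * beta * uQd) <= eta ^+ 2 * (rho2^-1 * U + g / 4) ->
  - (eta * hQd) <= eta ^+ 2 * (2^-1 * H + K8 / 2 * g) ->
  4 / 3 * (3 / 2 * (k1 * beta) ^+ 2 * rho ^+ 2 + (k1 + 1) / 2 * beta ^+ 2 * rho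
     + (k1 + 1) ^+ 2 + 3 / 2 * beta ^+ 2 + k1 ^+ 2)
  <= 3 * (k1 * beta) ^+ 2 * rho ^+ 2 + 2 * beta ^+ 2 ->
  W - eta * alpha * pLp - eta * alpha * pLe + eta * beta * ue - eta * ph
  + eta * beta * X + eta * beta * pe - eta * beta * U - eta * hu
  + c * uQd + pQd + 2^-1 * eta ^+ 2 * ww + c / 2 * (eta * beta) ^+ 2 * aLa
  + c * eta * beta * ad + c / 2 * dQd
  - eta ^+ 2 * beta * (alpha * aLa + beta * ua + ha)
  - eta * (alpha * ad + beta * uQd + hQd) <= W
  - eta * (alpha / 2 * rho2 - 1 / 4 * (9 * beta + 4 + 5 * Lf ^+ 2) + Lf ^+ 2 / 2
     - eta * (3 * Lf ^+ 2 + 2 * beta ^+ 2 + 1 + 3 * alpha ^+ 2 * rho ^+ 2)) * X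
  - eta * (beta / 2 - 3 * rho2^-1 - eta * (2 * beta ^+ 2 * rho + rho2^-1)) * U
  + eta * (K7 + K8 / 2 + eta * (K4 / 2 + 3 / 4 + K8 / 2)) * g
  + (eta * (alpha * rho / 2 + 2 * beta * rho + beta) + 4 * eta ^+ 2 *
  (3 / 2 * (k1 * beta) ^+ 2 * rho ^+ 2 + (k1 + 1) / 2 * beta ^+ 2 * rho
     + (k1 + 1) ^+ 2 + 3 / 2 * beta ^+ 2 + k1 ^+ 2)) * E.
Proof.
move=> rho0 c0 k0 eta0 a0 b0 alphaE cE X0 U0 aLa0.
rewrite -!alphaE -!cE.
set M := 3 / 2 * _ ^+ 2 * _ + _ + _ + _ + _ => hLp hLa hA hh.
have e2 : 0 <= eta ^+ 2 by rewrite sqr_ge0.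
have M0 : 0 <= M by rewrite !addr_ge0 ?mulr_ge0 ?sqr_ge0.
(* Each premise is multiplied beforehand by the weight it has in the final combination, so that only
   linear arithmetic over monomials is left. *)
have wt (x y z : R) : y <= z -> 0 <= x -> 0 <= x * (z - y).
  by move=> yz x0; rewrite mulr_ge0// subr_ge0.
move=> /(wt (eta * alpha) _ _) w1 /(wt (eta * beta) _ _) w2 /(wt eta _ _) w3 /(wt (eta * beta) _ _) w4.
move=> /(wt eta _ _) w6 b7 b8 /(wt (eta ^+ 2 / 2) _ _) v1 c3 c4.
move=> /(wt (eta ^+ 2 * beta ^+ 2) _ _) v5 /(wt (eta ^+ 2) _ _) v6 c7 c8 c9.
move=> /(wt (eta ^+ 2 * X) _ _) vM.
have {}w1 := w1 (mulr_ge0 eta0 a0); have {}w2 := w2 (mulr_ge0 eta0 b0).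
have {}w3 := w3 eta0; have {}w4 := w4 (mulr_ge0 eta0 b0); have {}w6 := w6 eta0.
have {}v1 := v1 (divr_ge0 e2 (ler0n _ 2)); have {}v6 := v6 e2.
have {}v5 := v5 (mulr_ge0 e2 (sqr_ge0 _)); have {}vM := vM (mulr_ge0 e2 X0).
have {hA} vA := wt _ _ _ hA (mulr_ge0 e2 M0).
have {hLp} w1' := wt _ _ _ hLp (mulr_ge0 eta0 a0).
have {hLa} v2 := wt _ _ _ hLa (mulr_ge0 (divr_ge0 c0 (ler0n _ 2)) (sqr_ge0 (eta * beta))).
have {hh wt} wH : 0 <= (eta * (7 / 12) + eta ^+ 2 * (5 / 2)) * (Lf ^+ 2 * X - H).
  by apply: wt => //; rewrite addr_ge0 ?mulr_ge0 ?divr_ge0.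
have v2' : 0 <= eta ^+ 2 * beta * alpha * aLa by rewrite !mulr_ge0.
have s1 : 0 <= eta * beta * X by rewrite !mulr_ge0.
have L2 : 0 <= Lf ^+ 2 by rewrite sqr_ge0.
have B2 : 0 <= beta ^+ 2 by rewrite sqr_ge0.
have s2 : 0 <= eta * Lf ^+ 2 * X := mulr_ge0 (mulr_ge0 eta0 L2) X0.
have s3 : 0 <= eta ^+ 2 * X := mulr_ge0 e2 X0.
have s4 : 0 <= eta ^+ 2 * Lf ^+ 2 * X := mulr_ge0 (mulr_ge0 e2 L2) X0.
have s5 : 0 <= eta * beta * U := mulr_ge0 (mulr_ge0 eta0 b0) U0.
have s6 : 0 <= eta ^+ 2 * beta ^+ 2 * rho * U.
  exact: mulr_ge0 (mulr_ge0 (mulr_ge0 e2 B2) rho0) U0.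
rewrite /M in vA vM *.
clear alphaE cE X0 U0 aLa0 e2 M0 M rho0 c0 k0 eta0 a0 b0 L2 B2.
lra.
Qed.

Section CoreDescent.
Variables (R : realType) (n d : nat) (L Q K : 'M[R]_n) (rho rho2 : R).
Hypotheses (LT : L^T = L) (QT : Q^T = Q) (LQ : L *m Q = K) (QL : Q *m L = K)
  (QK : Q *m K = Q) (KT : K^T = K).
Hypotheses (rho2_gt0 : 0 < rho2) (rho2_le : rho2 <= rho).
Hypothesis gap : forall X : 'M[R]_(n, d), K *m X = X ->
  rho2 * mdot X X <= mdot X (L *m X).
Hypothesis psd : forall X : 'M[R]_(n, d), 0 <= mdot X (L *m X).
Hypothesis radius : forall X : 'M[R]_(n, d), mdot X (L *m X) <= rho * mdot X X.
Implicit Types X Y U : 'M[R]_(n, d).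

Let rho_gt0 : 0 < rho. Proof. exact: lt_le_trans rho2_le. Qed.

Lemma mdotL X Y : mdot (L *m X) Y = mdot X (L *m Y).
Proof. by rewrite mdot_mulmx LT. Qed.

Lemma mdotQ X Y : mdot (Q *m X) Y = mdot X (Q *m Y).
Proof. by rewrite mdot_mulmx QT. Qed.

Lemma KQ : K *m Q = Q.
Proof. by apply: trmx_inj; rewrite trmx_mul QT KT QK. Qed.

(** The operator inequality [L^2 <= rho L] without diagonalization: expand the nonnegative form of
    [L] at [X - rho^-1 L X], and bound the cubic term by [radius]. *)
Lemma sqr_mulL_le X : mdot (L *m X) (L *m X) <= rho * mdot X (L *m X).
Proof.
have := psd (X - rho^-1 *: (L *m X)).
rewrite mulmxBr -scalemxAr !(mdotDl, mdotDr, mdotNl, mdotNr, mdotZl, mdotZr).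
rewrite -(mdotL X (L *m X)).
have := radius (L *m X).
move: (mdot (L *m X) (L *m X)) (mdot X (L *m X)) (mdot (L *m X) (L *m (L *m X))).
move=> a b g h'.
have {}h' : rho^-1 * (rho^-1 * g) <= rho^-1 * a.
  by rewrite ler_pM2l ?invr_gt0// ler_pdivrMl.
rewrite -ler_pdivrMl//; lra.
Qed.

Lemma sqr_mulL_le2 X : mdot (L *m X) (L *m X) <= rho ^+ 2 * mdot X X.
Proof.
by apply: (le_trans (sqr_mulL_le X)); rewrite expr2 -mulrA ler_pM2l.
Qed.

Lemma sqr_mulQ_le U : K *m U = U ->
  mdot (Q *m U) (Q *m U) <= rho2^-1 * mdot U (Q *m U).
Proof.
move=> KU; have := @gap (Q *m U).
rewrite mulmxA KQ => /(_ erefl).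
by rewrite mulmxA LQ KU mdotQ -mdotQ ler_pdivlMl// (mdotC _ U).
Qed.

Lemma sqr_le_mulQ U : K *m U = U -> mdot U U <= rho * mdot U (Q *m U).
Proof.
move=> KU; have := sqr_mulL_le (Q *m U).
by rewrite mulmxA LQ KU (mdotC _ U).
Qed.

Lemma mulQ_le U : K *m U = U -> mdot U (Q *m U) <= rho2^-1 * mdot U U.
Proof.
move=> KU; have h1 := sqr_mulQ_le KU.
have := mdot_young U (Q *m U) (a := rho2^-1); rewrite invr_gt0 => /(_ rho2_gt0).
rewrite invfM invrK; set q := mdot (Q *m U) (Q *m U) in h1 *.
move: h1; rewrite ler_pdivlMl// => h1 h2; lra.
Qed.

Lemma sqr_mulQ_le2 U : K *m U = U ->
  mdot (Q *m U) (Q *m U) <= rho2^-1 ^+ 2 * mdot U U.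
Proof.
move=> KU; apply: (le_trans (sqr_mulQ_le KU)).
by rewrite expr2 -mulrA ler_pM2l ?invr_gt0// mulQ_le.
Qed.

(* [X] stands for the centered iterate and [U] for the centered dual variable
   [v + g / beta], [g] being the gradients at the average iterate. For
   [c = (alpha + beta) / beta] the first-order cross terms [<X, U>] produced by
   the three summands cancel. *)
Definition lyap (c : R) X U : R :=
  2^-1 * mdot X X + c / 2 * mdot U (Q *m U) + mdot X (Q *m U).

Lemma mulQ_ge0 U : K *m U = U -> 0 <= mdot U (Q *m U).
Proof.
move=> /sqr_le_mulQ; rewrite -(pmulr_rge0 _ rho_gt0).
exact: le_trans (mdot_ge0 _).
Qed.

(** By Young the cross term costs [|X|^2 / 2 + |Q U|^2 / 2], and the spectral gap bounds [|Q U|^2]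
    by [rho2^-1 <U, Q U>]. *)
Lemma lyap_ge0 c X U : rho2^-1 <= c -> K *m U = U -> 0 <= lyap c X U.
Proof.
move=> hc KU; rewrite /lyap.
have := mdot_youngN X (Q *m U) (@ltr01 R).
have := sqr_mulQ_le KU.
have : rho2^-1 * mdot U (Q *m U) <= c * mdot U (Q *m U).
  by rewrite ler_wpM2r// mulQ_ge0.
rewrite mulr1; lra.
Qed.

(** The large factor on the left is the total weight of [|a|^2] in the terms of order [eta^2], and
    4/3 comes from [|a|^2 <= 4/3 |p|^2 + 4 |e|^2]. The bound makes it fit into [teps2]: the leading
    term uses two of the three units of [(k1 beta rho)^2], and the lower-order ones share the third,
    being small because [k1 rho >= 9/2] and [beta rho >= 6]. *)
Lemma descent_coef_le (k1 beta : R) : 0 < beta -> 1 <= k1 -> 9 / 2 <= k1 * rho2 ->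
  6 <= beta * rho2 ->
  4 / 3 * (3 / 2 * (k1 * beta) ^+ 2 * rho ^+ 2 + (k1 + 1) / 2 * beta ^+ 2 * rho
     + (k1 + 1) ^+ 2 + 3 / 2 * beta ^+ 2 + k1 ^+ 2)
  <= 3 * (k1 * beta) ^+ 2 * rho ^+ 2 + 2 * beta ^+ 2.
Proof.
move=> b0 k1_ge1 hk hb.
have k0 : 0 < k1 by apply: lt_le_trans k1_ge1.
have {}hk : 9 / 2 <= k1 * rho by apply: (le_trans hk); rewrite ler_pM2l.
have {}hb : 6 <= beta * rho by apply: (le_trans hb); rewrite ler_pM2l.
pose s := beta * rho.
have h1 : (k1 + 1) / 2 * beta ^+ 2 * rho <= 2 / 9 * (k1 * s) ^+ 2.
  have e1 : (k1 + 1) / 2 * beta ^+ 2 * rho <= k1 * beta ^+ 2 * rho.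
    by rewrite ler_pM2r// ler_pM2r ?exprn_gt0//; lra.
  apply: (le_trans e1).
  have -> : 2 / 9 * (k1 * s) ^+ 2 = (2 / 9 * (k1 * rho)) * (k1 * beta ^+ 2 * rho).
    by rewrite /s; ring.
  apply: ler_peMl; last lra.
  by rewrite !mulr_ge0// ?exprn_ge0 ?ltW.
have s2 : 36 <= s ^+ 2.
  by rewrite (_ : 36 = 6 ^+ 2 :> R); [rewrite ler_sqr ?nnegrE//; rewrite /s; lra|ring].
have h2 : k1 ^+ 2 <= 36^-1 * (k1 * s) ^+ 2.
  by rewrite exprMn mulrCA; apply: ler_peMr; [rewrite exprn_ge0// ltW|lra].
have h3 : (k1 + 1) ^+ 2 <= 4 * k1 ^+ 2.
  by rewrite (_ : 4 * _ = (2 * k1) ^+ 2); [rewrite ler_sqr ?nnegrE; lra|ring].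
have -> : 3 * (k1 * beta) ^+ 2 * rho ^+ 2 = 3 * (k1 * s) ^+ 2 by rewrite /s; ring.
have -> : 3 / 2 * (k1 * beta) ^+ 2 * rho ^+ 2 = 3 / 2 * (k1 * s) ^+ 2 by rewrite /s; ring.
have : 0 <= (k1 * s) ^+ 2 by rewrite sqr_ge0.
lra.
Qed.

(** An exact expansion, no estimate yet. [Q L = K] turns [Q (L a)] into [a], so no product with the
    pseudo-inverse survives except against [u] and the drift [dl]. *)
Lemma lyap_step c eta alpha beta (p e u h dl : 'M[R]_(n, d)) :
  c * beta = alpha + beta -> K *m p = p -> K *m e = e -> K *m u = u ->
  let a := p + e in
  let w := alpha *: (L *m a) + beta *: u + h in
  lyap c (p - eta *: w) (u + (eta * beta) *: (L *m a) + dl) = lyap c p u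
  - eta * alpha * mdot p (L *m p) - eta * alpha * mdot p (L *m e)
  + eta * beta * mdot u e - eta * mdot p h
  + eta * beta * mdot p p + eta * beta * mdot p e
  - eta * beta * mdot u (Q *m u) - eta * mdot h (Q *m u)
  + c * mdot u (Q *m dl) + mdot p (Q *m dl)
  + 2^-1 * eta ^+ 2 * mdot w w + c / 2 * (eta * beta) ^+ 2 * mdot a (L *m a)
  + c * eta * beta * mdot a dl + c / 2 * mdot dl (Q *m dl)
  - eta ^+ 2 * beta * (alpha * mdot a (L *m a) + beta * mdot u a + mdot h a)
  - eta * (alpha * mdot a dl + beta * mdot u (Q *m dl) + mdot h (Q *m dl)).
Proof.
move=> hc Kp Ke Ku a w.
have aE : a = p + e by [].
have wE : w = alpha *: (L *m a) + beta *: u + h by [].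
clearbody w; clearbody a.
have Ka : K *m a = a by rewrite aE mulmxDr Kp Ke.
have Qu : Q *m (u + (eta * beta) *: (L *m a) + dl) =
    Q *m u + (eta * beta) *: a + Q *m dl.
  by rewrite !mulmxDr -scalemxAr mulmxA QL Ka.
have LaQ X : mdot (L *m a) (Q *m X) = mdot a X.
  by rewrite mdotL mulmxA LQ -KT -mdot_mulmx Ka.
have wX X : mdot w X = alpha * mdot (L *m a) X + beta * mdot u X + mdot h X.
  by rewrite wE !(mdotDl, mdotZl).
have Xw X : mdot X w = alpha * mdot (L *m a) X + beta * mdot u X + mdot h X.
  by rewrite mdotC wX.
have aX X : mdot a X = mdot p X + mdot e X by rewrite aE mdotDl.
have ww : mdot (p - eta *: w) (p - eta *: w) =
    mdot p p - 2 * eta * mdot p w + eta ^+ 2 * mdot w w.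
  rewrite !(mdotDl, mdotDr, mdotNl, mdotNr, mdotZl, mdotZr) (mdotC w p); ring.
rewrite /lyap ww Qu.
rewrite (_ : mdot (u + _ + dl) _ = mdot u (Q *m u) + 2 * eta * beta * mdot u a
   + 2 * mdot u (Q *m dl) + (eta * beta) ^+ 2 * mdot a (L *m a)
   + 2 * eta * beta * mdot a dl + mdot dl (Q *m dl)); last first.
  rewrite !(mdotDl u, mdotDl _ dl, mdotDr _ (Q *m u), mdotDr _ _ (Q *m dl)).
  rewrite !(mdotZl, mdotZr) !LaQ (mdotL a a) (mdotC a u) (mdotC dl a).
  rewrite -(mdotQ dl u) (mdotC (Q *m dl)); ring.
rewrite (_ : mdot (p - _) _ = mdot p (Q *m u) + eta * beta * mdot p a
   + mdot p (Q *m dl) - eta * (mdot w (Q *m u) + eta * beta * mdot w a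
   + mdot w (Q *m dl))); last first.
  rewrite (mdotDl p) mdotNl mdotZl !(mdotDr _ (Q *m u), mdotDr _ _ (Q *m dl)).
  rewrite !mdotZr; ring.
rewrite (wX (Q *m u)) (wX a) (wX (Q *m dl)) !LaQ (mdotL a a) (Xw p) (mdotL a p).
rewrite (aX u) (aX (L *m p)) (mdotC u a) (aX u) (mdotC p a) (aX p).
rewrite (mdotC u p) (mdotC u e) (mdotC h p) (mdotC p e) -(mdotL e p) (mdotC (L *m e) p).
have -> : alpha = c * beta - beta by rewrite hc addrK.
by field.
Qed.

(** The part linear in [eta] comes from the products of [e] with [L p], [u] and [p]; the factor
    [4 eta^2] comes from splitting [|a|^2] into [|p|^2] and [|e|^2]. *)
Definition noise_coef (eta alpha beta k1 : R) : R :=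
  eta * (alpha * rho / 2 + 2 * beta * rho + beta) + 4 * eta ^+ 2 *
  (3 / 2 * (k1 * beta) ^+ 2 * rho ^+ 2 + (k1 + 1) / 2 * beta ^+ 2 * rho
     + (k1 + 1) ^+ 2 + 3 / 2 * beta ^+ 2 + k1 ^+ 2).

Lemma noise_coef_ge0 eta alpha beta k1 : 0 <= rho -> 0 <= eta -> 0 <= alpha ->
  0 <= beta -> 0 <= k1 -> 0 <= noise_coef eta alpha beta k1.
Proof.
by move=> *; rewrite /noise_coef !addr_ge0 ?mulr_ge0 ?addr_ge0 ?mulr_ge0 ?exprn_ge0 ?addr_ge0 ?mulr_ge0.
Qed.

(** [G] stands for [n |gbar|^2], which controls the drift [dl]. The Young weights are tuned to the
    constants [eps] and leave a surplus [Lf^2 / 2] in the decay of [|p|^2], spent later on the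
    distance between [gbar] and the true gradient. *)
Lemma lyap_descent (c k1 eta alpha beta Lf G : R) (p e u h dl : 'M[R]_(n, d)) :
  alpha = k1 * beta -> c = k1 + 1 -> 0 < eta -> 0 < beta -> 1 <= k1 ->
  9 / 2 <= k1 * rho2 -> 6 <= beta * rho2 ->
  K *m p = p -> K *m e = e -> K *m u = u -> K *m dl = dl ->
  mdot h h <= Lf ^+ 2 * mdot p p ->
  mdot dl dl <= eta ^+ 2 * (Lf ^+ 2 * G) / beta ^+ 2 ->
  lyap c (p - eta *: (alpha *: (L *m (p + e)) + beta *: u + h))
         (u + (eta * beta) *: (L *m (p + e)) + dl) <= lyap c p u
  - eta * (alpha / 2 * rho2 - 1 / 4 * (9 * beta + 4 + 5 * Lf ^+ 2) + Lf ^+ 2 / 2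
     - eta * (3 * Lf ^+ 2 + 2 * beta ^+ 2 + 1 + 3 * alpha ^+ 2 * rho ^+ 2)) * mdot p p
  - eta * (beta / 2 - 3 * rho2^-1 - eta * (2 * beta ^+ 2 * rho + rho2^-1))
     * mdot u (Q *m u)
  + eta * (c ^+ 2 * Lf ^+ 2 / (beta ^+ 3 * rho2) + Lf ^+ 2 / (2 * beta ^+ 2 * rho2 ^+ 2)
     + eta * (c * Lf ^+ 2 / (2 * beta ^+ 2 * rho2) + 3 * Lf ^+ 2 / 4
        + Lf ^+ 2 / (2 * beta ^+ 2 * rho2 ^+ 2))) * G
  + noise_coef eta alpha beta k1 * mdot e e.
Proof.
move=> alphaE cE eta0 b0 k1_ge1 hk hb Kp Ke Ku Kd hh hd.
have k0 : 0 < k1 by apply: lt_le_trans k1_ge1.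
have a0 : 0 < alpha by rewrite alphaE mulr_gt0.
have c0 : 0 < c by rewrite cE addr_gt0.
rewrite lyap_step//; last by rewrite cE alphaE; ring.
have [a aE] : exists a, a = p + e by eexists.
rewrite -aE; have [w wE] : exists w, w = alpha *: (L *m a) + beta *: u + h by eexists.
rewrite -wE.
have X0 := mdot_ge0 p; have E0 := mdot_ge0 e; have A0 := mdot_ge0 a.
have U0 := mulQ_ge0 Ku; have D0 := mdot_ge0 dl.
have r0 : 0 < rho2^-1 by rewrite invr_gt0.
have hA : mdot a a <= 4 / 3 * mdot p p + 4 * mdot e e.
  have := @mdot_sqrD_le _ _ _ 3^-1 p e; rewrite -aE invr_gt0 ltr0n => /(_ isT).
  rewrite invrK; lra.
have hu := sqr_le_mulQ Ku.
have hq := sqr_mulQ_le Ku.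
have hQd := sqr_mulQ_le2 Kd.
have hdQd := mulQ_le Kd.
have hLp := gap Kp.
have hLe := radius e.
have hLa := radius a.
have hLL := sqr_mulL_le2 a.
have hpsd := psd a.
(* Young's inequality for the semi-inner product of [L]: the difference of the two sides is half of
   [<a, L a>] plus half of [rho |e|^2 - <e, L e>]. *)
have b1 : - mdot p (L *m e) <= 2^-1 * mdot p (L *m p) + rho / 2 * mdot e e.
  rewrite -subr_ge0 [leRHS](_ : _ = 2^-1 * mdot a (L *m a) +
    2^-1 * (rho * mdot e e - mdot e (L *m e))).
    by rewrite addr_ge0 ?mulr_ge0 ?invr_ge0 ?subr_ge0.
  by rewrite aE mulmxDr !(mdotDl, mdotDr) -(mdotL e p) (mdotC _ p); field.
have b2 : mdot u e <= 8^-1 * mdot u (Q *m u) + 2 * rho * mdot e e.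
  have := @mdot_norm_le _ _ _ (8 * rho)^-1 (2 * rho) u e.
  rewrite invr_gt0 mulr_gt0// => /(_ isT).
  have -> : 4 * (8 * rho)^-1 * (2 * rho) = 1 by field; rewrite gt_eqF.
  move=> /(_ (lexx _)) /(le_trans (ler_norm _))/le_trans; apply.
  by rewrite lerD2r// invfM -mulrA ler_pM2l// ler_pdivrMl.
have b3 : - mdot p h <= 2^-1 * mdot p p + 2^-1 * mdot h h.
  by rewrite (le_trans (ler_norm _))// normrN mdot_norm_le//; lra.
have b4 : mdot p e <= 4^-1 * mdot p p + 1 * mdot e e.
  by rewrite (le_trans (ler_norm _))// mdot_norm_le//; lra.
have b6 : - mdot h (Q *m u) <= 12^-1 * mdot h h + 3 * (rho2^-1 * mdot u (Q *m u)).
  rewrite (le_trans (ler_norm _))// normrN.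
  have i1 := @mdot_norm_le _ _ _ 12^-1 3 h (Q *m u).
  apply: (le_trans (i1 _ _)); [lra|lra|].
  by rewrite lerD2l ler_pM2l.
have [g gE] : exists g, g = Lf ^+ 2 * G by eexists.
rewrite -gE in hd.
(* [yq] and [ya] leave the weights open; below, they are always chosen with [4 x y = 1], the
   equality case of Young. *)
have yq x y : 0 < x -> 1 <= 4 * x * y -> 0 <= y -> `|mdot u (Q *m dl)| <=
    x * (rho2^-1 * mdot u (Q *m u)) + y * (eta ^+ 2 * g / beta ^+ 2).
  move=> x0 xy y0; rewrite -mdotQ (le_trans (mdot_norm_le _ _ x0 xy))//.
  by rewrite lerD ?ler_wpM2l// ltW.
have ya x y : 0 < x -> 1 <= 4 * x * y -> 0 <= y -> `|mdot a dl| <=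
    x * mdot a a + y * (eta ^+ 2 * g / beta ^+ 2).
  move=> x0 xy y0; rewrite (le_trans (mdot_norm_le _ _ x0 xy))//.
  by rewrite lerD2l ?ler_wpM2l.
(* Introducing the constants through existentials hides their bodies, so that the arithmetic treats
   these fractions as atoms. *)
have [K4 K4E] : exists K4, K4 = c / (beta ^+ 2 * rho2) by eexists.
have [K7 K7E] : exists K7, K7 = c ^+ 2 / (beta ^+ 3 * rho2) by eexists.
have [K8 K8E] : exists K8, K8 = (beta ^+ 2 * rho2 ^+ 2)^-1 by eexists.
have -> : eta * (c ^+ 2 * Lf ^+ 2 / (beta ^+ 3 * rho2) +
     Lf ^+ 2 / (2 * beta ^+ 2 * rho2 ^+ 2) + eta *
     (c * Lf ^+ 2 / (2 * beta ^+ 2 * rho2) + 3 * Lf ^+ 2 / 4 +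
      Lf ^+ 2 / (2 * beta ^+ 2 * rho2 ^+ 2))) * G =
    eta * (K7 + K8 / 2 + eta * (K4 / 2 + 3 / 4 + K8 / 2)) * g.
  by rewrite gE K4E K7E K8E; field; rewrite !gt_eqF.
have nz : (beta != 0) && (rho2 != 0) && (c != 0) && (eta != 0) && (k1 != 0).
  by rewrite !gt_eqF.
have {nz} [/andP[/andP[/andP[bnz rnz] cnz] enz] knz] := andP nz.
have pos := (mulr_gt0, divr_gt0, invr_gt0, exprn_gt0, a0, b0, c0, eta0, k0, rho2_gt0).
have le_eq (x y : R) : x = y -> x <= y by move=> ->.
have b7 : c * mdot u (Q *m dl) <= eta * beta / 4 * mdot u (Q *m u) + eta * K7 * g.
  rewrite -ler_pdivlMl ?divr_gt0 ?mulr_gt0// (le_trans (ler_norm _))//.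
  apply: (le_trans (yq (eta * beta * rho2 / (4 * c)) (c / (eta * beta * rho2)) _ _ _)).
  - by rewrite !pos.
  - by apply: le_eq; field; rewrite bnz rnz cnz enz.
  - by rewrite ltW// !pos.
  - by apply: le_eq; rewrite K7E; field; rewrite bnz rnz cnz enz.
have hQd' X : `|mdot X (Q *m dl)| <= eta / 2 * mdot X X + eta * K8 / 2 * g.
  apply: (le_trans (@mdot_norm_le _ _ _ (eta / 2) (2 * eta)^-1 _ _ _ _)).
  - by rewrite !pos.
  - by apply: le_eq; field.
  - rewrite lerD2l ler_pdivrMl ?divr_gt0 ?mulr_gt0// (le_trans hQd)// -ler_pdivlMl ?exprn_gt0 ?divr_gt0 ?mulr_gt0// (le_trans hd)//.
    by apply: le_eq; rewrite K8E; field; rewrite bnz rnz.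
have b8 := le_trans (ler_norm _) (hQd' p).
have c1 : mdot w w <= 3 * (alpha ^+ 2 * rho ^+ 2 * mdot a a +
    beta ^+ 2 * rho * mdot u (Q *m u) + mdot h h).
  rewrite wE (le_trans (mdot_sqrD3_le _ _ _ _ _))// ler_pM2l// lerD2r -!mulrA.
  apply: lerD; rewrite !ler_pM2l//.
  by apply: (le_trans hLL); rewrite expr2 -mulrA.
have c3 : c * eta * beta * mdot a dl <= eta ^+ 2 * (c ^+ 2 * mdot a a + g / 4).
  rewrite -ler_pdivlMl ?divr_gt0 ?mulr_gt0// (le_trans (ler_norm _))//.
  apply: (le_trans (ya (c * eta / beta) (beta / (4 * c * eta)) _ _ _)).
  - by rewrite !pos.
  - by apply: le_eq; field; rewrite bnz cnz enz.
  - by rewrite ltW// !pos.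
  - by apply: le_eq; field; rewrite bnz cnz enz.
have c4 : c / 2 * mdot dl (Q *m dl) <= eta ^+ 2 * (K4 / 2) * g.
  rewrite -ler_pdivlMl ?divr_gt0 ?mulr_gt0// (le_trans hdQd)// ler_pdivrMl ?divr_gt0 ?mulr_gt0// (le_trans hd)//.
  by apply: le_eq; rewrite K4E; field; rewrite bnz rnz cnz.
have c5 : - mdot u a <= 4^-1 * rho * mdot u (Q *m u) + 1 * mdot a a.
  rewrite (le_trans (ler_norm _))// normrN.
  apply: (le_trans (@mdot_norm_le _ _ _ 4^-1 1 _ _ _ _)) => //.
    by apply: le_eq; field.
  by rewrite lerD2r -mulrA ler_pM2l.
have c6 : - (beta * mdot h a) <= 2^-1 * mdot h h + 2^-1 * beta ^+ 2 * mdot a a.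
  rewrite -mulrN -ler_pdivlMl ?divr_gt0 ?mulr_gt0// (le_trans (ler_norm _))// normrN.
  apply: (le_trans (@mdot_norm_le _ _ _ (2 * beta)^-1 (beta / 2) _ _ _ _)).
  - by rewrite !pos.
  - by apply: le_eq; field; rewrite bnz.
  - by apply: le_eq; field; rewrite bnz.
have c7 : - (eta * alpha * mdot a dl) <= eta ^+ 2 * (k1 ^+ 2 * mdot a a + g / 4).
  rewrite -mulrN -ler_pdivlMl ?divr_gt0 ?mulr_gt0// (le_trans (ler_norm _))// normrN.
  apply: (le_trans (ya (k1 * eta / beta) (beta / (4 * k1 * eta)) _ _ _)).
  - by rewrite !pos.
  - by apply: le_eq; field; rewrite bnz knz enz.
  - by rewrite ltW// !pos.
  - by apply: le_eq; rewrite alphaE; field; rewrite bnz knz enz.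
have c8 : - (eta * beta * mdot u (Q *m dl)) <=
    eta ^+ 2 * (rho2^-1 * mdot u (Q *m u) + g / 4).
  rewrite -mulrN -ler_pdivlMl ?divr_gt0 ?mulr_gt0// (le_trans (ler_norm _))// normrN.
  apply: (le_trans (yq (eta / beta) (beta / (4 * eta)) _ _ _)).
  - by rewrite !pos.
  - by apply: le_eq; field; rewrite bnz enz.
  - by rewrite ltW// !pos.
  - by apply: le_eq; field; rewrite bnz rnz enz.
have c9 : - (eta * mdot h (Q *m dl)) <= eta ^+ 2 * (2^-1 * mdot h h + K8 / 2 * g).
  rewrite -mulrN -ler_pdivlMl ?divr_gt0 ?mulr_gt0// (le_trans (ler_norm _))// normrN.
  apply: (le_trans (hQd' h)).
  by apply: le_eq; field; rewrite enz.
have M_le := descent_coef_le b0 k1_ge1 hk hb.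
rewrite /noise_coef.
have ge0 (x : R) : 0 < x -> 0 <= x by move/ltW.
apply: (@descent_arith R rho rho2 c k1 eta alpha beta Lf g K4 K7 K8 _
  (mdot p p) (mdot e e) (mdot a a) (mdot u (Q *m u)) (mdot h h)) => //;
  apply: ge0 => //.
Qed.

End CoreDescent.

(** * The descent lemma *)

Section Calculus.
Variables (R : realType) (d : nat).
Implicit Types (f : 'rV[R]_d -> R) (x y h : 'rV[R]_d).

Lemma derive_gradient f x h : differentiable f x ->
  'D_h f x = mdot (gradient f x) h.
Proof.
move=> df; rewrite deriveE// [in LHS](row_sum_delta h) linear_sum/=.
rewrite mdotE big_ord1; apply: eq_bigr => j _.
by rewrite linearZ/= mxE deriveE// mulrC.
Qed.

Lemma is_derive_line f x h (t : R) : (forall y, differentiable f y) ->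
  is_derive t 1 (fun s => f (x + s *: h)) (mdot (gradient f (x + t *: h)) h).
Proof.
move=> df.
have e : (fun s : R => s^-1 *: ((((fun r => f (x + r *: h)) \o shift t) (s *: 1)) -
      f (x + t *: h))) =
    (fun s : R => s^-1 *: ((f \o shift (x + t *: h)) (s *: h) - f (x + t *: h))).
  apply/funext => s /=; congr (_ *: (f _ - _)).
  by rewrite [s *: 1]mulr1 scalerDl addrCA.
have dl : derivable f (x + t *: h) h by exact: diff_derivable.
split; first by rewrite /derivable e.
by rewrite -derive_gradient// /derive e.
Qed.

(* Mean value theorem for the gap between [f] on the segment and its quadratic upper model. *)
Lemma descent_lemma f (l : R) x h : (forall y, differentiable f y) -> 0 < l ->
  (forall y z, norm2 (gradient f y - gradient f z) <= l * norm2 (y - z)) ->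
  f (x + h) <= f x + mdot (gradient f x) h + l / 2 * mdot h h.
Proof.
move=> df l0 lip.
pose c := mdot (gradient f x) h; pose b := l / 2 * mdot h h.
pose phi (s : R) := f (x + s *: h) - s * c - s ^+ 2 * b.
pose dphi (s : R) := mdot (gradient f (x + s *: h)) h - c - 2 * s * b.
have dP (s : R) : is_derive s 1 phi (dphi s).
  have i1 := is_derive_line x h s df.
  have i2 : is_derive s 1 (fun r : R => r * c) c.
    by apply: is_derive_eq; rewrite scaler0 add0r [c *: 1]mulr1.
  have i3 : is_derive s 1 (fun r : R => r ^+ 2 * b) (2 * s * b).
    by apply: is_derive_eq; rewrite scaler0 add0r /GRing.scale/=; ring.
  exact: is_deriveB (is_deriveB i1 i2) i3.
have [|s] := MVT (@ltr01 R) (fun s _ => dP s).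
  by apply: derivable_within_continuous => s _; have [] := dP s.
rewrite in_itv/= => /andP[s0 s1].
rewrite /phi subr0 mulr1 scale1r scale0r addr0 expr1n expr0n/= !mul1r !mul0r !subr0.
suff : dphi s <= 0 by rewrite /dphi /b /c; lra.
have : mdot (gradient f (x + s *: h) - gradient f x) h <= l * s * mdot h h.
  have := lip (x + s *: h) x; rewrite addrAC subrr add0r.
  rewrite -(@ler_sqr _ (norm2 _)) ?nnegrE ?sqrtr_ge0//; last first.
    by rewrite mulr_ge0 ?sqrtr_ge0// ltW.
  rewrite exprMn !norm2_sqr mdotZl mdotZr => hsq.
  have ls0 : 0 < l * s by rewrite mulr_gt0.
  apply: (le_trans (ler_norm _)).
  apply: (le_trans (@mdot_norm_le _ _ _ (2 * (l * s))^-1 (l * s / 2) _ _ _ _)).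
  - by rewrite invr_gt0 mulr_gt0.
  - by rewrite le_eqVlt; apply/orP; left; apply/eqP; field; rewrite !gt_eqF.
  - have -> : l * s * mdot h h = l * s / 2 * mdot h h + l * s / 2 * mdot h h by field.
    rewrite lerD2r ler_pdivrMl ?mulr_gt0// (le_trans hsq)//.
    by rewrite le_eqVlt; apply/orP; left; apply/eqP; field.
rewrite /dphi /b /c mdotDl mdotNl; lra.
Qed.

Lemma gradient_mean_fun n (F : 'I_n -> 'rV[R]_d -> R) x :
  (forall i, differentiable (F i) x) ->
  gradient (mean_fun F) x = average (fun i => gradient (F i) x).
Proof.
move=> dF; apply/rowP => j; rewrite !mxE summxE.
have -> : mean_fun F = n%:R^-1 \*: \sum_i F i.
  by apply/funext => y; rewrite /mean_fun /= fct_sumE.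
have dd i : derivable (F i) x (delta_mx ord0 j) by exact: diff_derivable.
rewrite deriveZ ?derive_sum//; last exact: derivable_sum.
by congr (_ * _); apply: eq_bigr => i _; rewrite mxE.
Qed.

Lemma gradient_entry_continuous f (l : R) j : 0 < l ->
  (forall y z, norm2 (gradient f y - gradient f z) <= l * norm2 (y - z)) ->
  continuous (fun x => gradient f x ord0 j).
Proof.
move=> l0 lip x; apply/(@cvgrPdist_le _ _ _ (nbhs x) (nbhs_filter x)) => e e0.
have ld : 0 < l * d%:R + 1 by rewrite ltr_wpDl// mulr_ge0// ltW.
(* Balls are for the sup norm, so [|x - y|^2 <= d r^2]. The choice of [r] works because
   [l^2 d <= (l d + 1)^2], and [+ 1] covers [d = 0]. *)
pose r := e / (l * d%:R + 1).
have r0 : 0 < r by rewrite divr_gt0.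
have /= : nbhs x (ball x r) by exact: nbhsx_ballx.
apply: filterS => y [_ xy].
rewrite -(@ler_sqr _ `|_|) ?nnegrE// ?(ltW e0)// real_normK ?num_real//.
have i1 : (gradient f x ord0 j - gradient f y ord0 j) ^+ 2 <=
    mdot (gradient f x - gradient f y) (gradient f x - gradient f y).
  rewrite mdotE big_ord1 (bigD1 j)//= !mxE -expr2 lerDl.
  by apply: sumr_ge0 => k _; rewrite -expr2 sqr_ge0.
apply: (le_trans i1); have := lip x y.
rewrite -(@ler_sqr _ (norm2 _)) ?nnegrE ?sqrtr_ge0//; last first.
  by rewrite mulr_ge0 ?sqrtr_ge0// ltW.
rewrite exprMn !norm2_sqr => /le_trans; apply.
have i2 : mdot (x - y) (x - y) <= d%:R * r ^+ 2.
  rewrite mdotE big_ord1.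
  apply: (@le_trans _ _ (\sum_(k < d) r ^+ 2)); last first.
    by rewrite sumr_const card_ord mulr_natl.
  apply: ler_sum => k _; rewrite -expr2 -real_normK ?num_real// ler_sqr ?nnegrE ?(ltW r0)//.
  by have := xy ord0 k; rewrite /ball/= !mxE => /ltW.
apply: (@le_trans _ _ (l ^+ 2 * (d%:R * r ^+ 2))).
  by rewrite ler_pM2l// exprn_gt0.
have -> : l ^+ 2 * (d%:R * r ^+ 2) = (l ^+ 2 * d%:R / (l * d%:R + 1) ^+ 2) * e ^+ 2.
  by rewrite /r; field; rewrite gt_eqF.
rewrite ler_piMl ?sqr_ge0// ler_pdivrMr ?exprn_gt0// mul1r.
have dd : d%:R <= d%:R ^+ 2 :> R by rewrite -natrX ler_nat; case: (d) => // k; rewrite expnS leq_pmulr.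
have : l ^+ 2 * d%:R <= l ^+ 2 * d%:R ^+ 2 by rewrite ler_pM2l// exprn_gt0.
have : 0 <= l * d%:R by rewrite mulr_ge0// ltW.
move: (d%:R : R) => D; nra.
Qed.

End Calculus.

(** * Measurability *)

Section MeasurableVectors.
Context {dT : measure_display} {T : measurableType dT} {R : realType} {d : nat}.

Definition mvec (X : T -> 'rV[R]_d) : Prop :=
  forall j, measurable_fun [set: T] (fun w => X w ord0 j).

Lemma mvec_cst x : mvec (fun=> x).
Proof. by move=> j; exact: measurable_cst. Qed.

Lemma mvecD X Y : mvec X -> mvec Y -> mvec (fun w => X w + Y w).
Proof.
move=> mX mY j; under eq_fun do rewrite mxE.
exact: measurable_funD.
Qed.

Lemma mvecZ a X : mvec X -> mvec (fun w => a *: X w).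
Proof.
move=> mX j; under eq_fun do rewrite mxE.
by apply: measurable_funM => //; exact: measurable_cst.
Qed.

Lemma mvecN X : mvec X -> mvec (fun w => - X w).
Proof. by move=> mX; under eq_fun do rewrite -scaleN1r; exact: mvecZ. Qed.

Lemma mvecB X Y : mvec X -> mvec Y -> mvec (fun w => X w - Y w).
Proof. by move=> mX mY; apply: mvecD => //; exact: mvecN. Qed.

Lemma mvec_sum n (X : 'I_n -> T -> 'rV[R]_d) : (forall i, mvec (X i)) ->
  mvec (fun w => \sum_i X i w).
Proof.
move=> mX j; under eq_fun do rewrite summxE.
by apply: measurable_sum => i; exact: mX.
Qed.

Lemma mvec_norm2_sqr X : mvec X -> measurable_fun [set: T] (fun w => norm2 (X w) ^+ 2).
Proof.
move=> mX; have -> : (fun w => norm2 (X w) ^+ 2) = (fun w => \sum_j X w ord0 j ^+ 2).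
  apply/funext => w; rewrite norm2_sqr mdotE big_ord1.
  by apply: eq_bigr => j _; rewrite expr2.
by apply: measurable_sum => j; exact: measurable_funX.
Qed.

(* An open subset of R^d is a countable union of cubes with rational centers and radii [1/m]. *)
Lemma mvec_preimage_open X (U : set 'rV[R]_d) : mvec X -> open U ->
  measurable (X @^-1` U).
Proof.
move=> mX oU.
pose c (q : 'rV[rat]_d) : 'rV[R]_d := map_mx ratr q.
pose F (z : 'rV[rat]_d * nat) : set T :=
  if `[< ball (c z.1) z.2.+1%:R^-1 `<=` U >]
  then \bigcap_(j in [set: 'I_d]) ((fun w => X w ord0 j) @^-1` ball (c z.1 ord0 j) z.2.+1%:R^-1)
  else set0.
have mF z : measurable (F z).
  rewrite /F; case: ifP => // _; apply: fin_bigcap_measurable => //.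
  move=> j _; rewrite -[X in measurable X]setTI; apply: mX => //.
  exact: measurable_ball.
have -> : X @^-1` U = \bigcup_k (if unpickle k is Some z then F z else set0).
  apply/seteqP; split => [w /= Uw|w [k _]]; last first.
    case: unpickle => // z; rewrite /F; case: ifP => // /asboolP zU wF.
    apply: zU; split => // i j; rewrite ord1; exact: wF.
  have /nbhs_ballP[e /= e0 eU] : nbhs (X w) U by exact: open_nbhs_nbhs.
  pose m := Num.truncn (2 / e).
  have mP : m.+1%:R^-1 < e / 2.
    rewrite invf_plt ?posrE ?divr_gt0// invf_div.
    by rewrite truncnS_gt ?divr_ge0// ltW.
  have /choice[q qP] : forall j : 'I_d, exists q : rat,
      ratr q \in `](X w ord0 j), (X w ord0 j + m.+1%:R^-1)[.
    by move=> j; apply: rat_in_itvoo; rewrite ltrDl invr_gt0.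
  pose z : 'rV[rat]_d * nat := (\row_j q j, m).
  have zb j : ball (c z.1 ord0 j) z.2.+1%:R^-1 (X w ord0 j).
    rewrite /ball/= /c !mxE; have := qP j; rewrite in_itv/= => /andP[h1 h2].
    by rewrite gtr0_norm ?subr_gt0// ltrBlDl.
  exists (pickle z) => //; rewrite pickleK /F ifT; first by move=> j _; exact: zb.
  apply/asboolP => y [_ zy]; apply: eU; split => // i j.
  rewrite ord1; apply: (@ball_splitr _ _ (c z.1 ord0 j)).
    move: (zb j); apply: le_ball; exact: ltW.
  by move: (zy ord0 j); apply: le_ball; exact: ltW.
apply: bigcupT_measurable => k; case: unpickle => [z|]; first exact: mF.
exact: measurable0.
Qed.

Lemma mvec_continuous X (g : 'rV[R]_d -> R) : mvec X -> continuous g ->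
  measurable_fun [set: T] (fun w => g (X w)).
Proof.
move=> mX cg mT; apply: (measurability _ (RGenOInfty.measurableE R)) => //.
move=> _ [_ [a ->] <-]; rewrite setTI.
have -> : (fun w => g (X w)) @^-1` `]a, +oo[%classic = X @^-1` (g @^-1` `]a, +oo[%classic) by [].
apply: mvec_preimage_open => //; apply: open_comp; first by move=> x _; exact: cg.
exact: interval_open.
Qed.

End MeasurableVectors.

(** * Measurability of the iterates *)

Section AlgorithmMeasurability.
Context {dX : measure_display} {Xi : measurableType dX} {R : realType} {n d : nat}.
Variable cmp : Xi -> 'rV[R]_d -> 'rV[R]_d.
Hypothesis hcmp : random_map cmp.

Lemma mvec_random_map {dT : measure_display} {T : measurableType dT}
    (u : T -> Xi) (z : T -> 'rV[R]_d) :
  measurable_fun [set: T] u -> mvec z -> mvec (fun w => cmp (u w) (z w)).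
Proof.
move=> mu mz j.
have -> : (fun w => cmp (u w) (z w) ord0 j) =
    (fun a : Xi * d.-tuple R => cmp a.1 (\row_(l < d) tnth a.2 l) ord0 j) \o
    (fun w => (u w, [tuple z w ord0 l | l < d])).
  apply/funext => w /=; congr (cmp _ _ _ _); apply/rowP => l.
  by rewrite mxE tnth_mktuple.
apply: measurableT_comp; first exact: hcmp.
apply: measurable_fun_pair => //; apply/measurable_fun_tnthP => l.
have -> : (@tnth d R ^~ l) \o (fun w => [tuple z w ord0 l | l < d]) = (fun w => z w ord0 l).
  by apply/funext => w /=; rewrite tnth_mktuple.
exact: mz.
Qed.

Variable f : 'I_n -> 'rV[R]_d -> R.
Hypothesis grad_cont : forall i j, continuous (fun x => gradient (f i) x ord0 j).
Context {dT : measure_display} {T : measurableType dT}.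
Variables (L : 'M[R]_n) (xi : nat -> 'I_n -> T -> Xi).
Variables (alpha beta eta : R) (s : nat -> R) (x0 : 'I_n -> 'rV[R]_d).
Variables (x xh y v q : nat -> 'I_n -> T -> 'rV[R]_d).
Hypothesis alg : algorithm3 L f cmp xi alpha beta eta s x0 x xh y v q.

(** The sigma-algebra on [T] is left free and only seeds before [k] are assumed measurable. On
    [Omega] this gives plain measurability; on the sigma-algebra of the past it says that the input
    of the compressor at time [k] depends on earlier seeds only. Hence [prev xh] and [prev y]:
    [xh k] and [y k] already involve the seeds of time [k]. *)
Lemma algorithm3_measurable k :
  (forall m i, (m < k)%N -> measurable_fun [set: T] (xi m i)) ->
  [/\ forall i, mvec (x k i), forall i, mvec (Defs.prev xh k i),
      forall i, mvec (Defs.prev y k i) & forall i, mvec (v k i)].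
Proof.
elim: k => [_|k IHk mxi].
  split=> i.
  - by rewrite (_ : x 0%N i = fun=> x0 i); [exact: mvec_cst|apply/funext => w; rewrite (alg_x0 alg)].
  - exact: mvec_cst.
  - exact: mvec_cst.
  - by rewrite (_ : v 0%N i = fun=> 0); [exact: mvec_cst|apply/funext => w; rewrite (alg_v0 alg)].
have [|mx mxh my mv] := IHk; first by move=> m i mk; apply: mxi; exact: ltnW.
have mq i : mvec (q k i).
  rewrite (_ : q k i = fun w => cmp (xi k i w) ((s k)^-1 *: (x k i w - Defs.prev xh k i w))).
    by apply: mvec_random_map; [exact: mxi|apply: mvecZ; exact: mvecB].
  by apply/funext => w; rewrite (alg_q alg).
have mxh' i : mvec (xh k i).
  rewrite (_ : xh k i = fun w => Defs.prev xh k i w + s k *: q k i w).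
    by apply: mvecD => //; exact: mvecZ.
  by apply/funext => w; rewrite (alg_xh alg).
have my' i : mvec (y k i).
  rewrite (_ : y k i = fun w => Defs.prev y k i w + s k *: q k i w
              - s k *: \sum_(j < n) L i j *: q k j w).
    apply: mvecB; first by apply: mvecD => //; exact: mvecZ.
    by apply: mvecZ; apply: mvec_sum => j; exact: mvecZ.
  by apply/funext => w; rewrite (alg_y alg).
split => // i.
- rewrite (_ : x k.+1 i = fun w => x k i w - (eta * alpha) *: (xh k i w - y k i w)
                 - eta *: (beta *: v k i w + gradient (f i) (x k i w))).
    apply: mvecB; first by apply: mvecB => //; apply: mvecZ; exact: mvecB.
    apply: mvecZ; apply: mvecD; first exact: mvecZ.
    by move=> j; exact: (mvec_continuous (mx i) (@grad_cont i j)).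
  by apply/funext => w; rewrite (alg_x alg).
- rewrite (_ : v k.+1 i = fun w => v k i w + (eta * beta) *: (xh k i w - y k i w)).
    by apply: mvecD => //; apply: mvecZ; exact: mvecB.
  by apply/funext => w; rewrite (alg_v alg).
Qed.

End AlgorithmMeasurability.

(** * Independence of a seed from the past *)

Section Freshness.
Context {dO : measure_display} {Omega : measurableType dO} {R : realType}
  (P : probability Omega R) {dX : measure_display} {Xi : measurableType dX}
  (mu : probability Xi R) {n : nat} (xi : nat -> 'I_n -> Omega -> Xi).
Hypothesis hxi : fresh_seeds P mu xi.

Definition past_index (k : nat) : seq (nat * 'I_n) :=
  [seq (m, i) | m <- iota 0 k, i <- enum 'I_n].

Lemma mem_past_index k m i : ((m, i) \in past_index k) = (m < k)%N.
Proof.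
apply/allpairsP/idP => [[[a b] /= [ha _ [-> _]]]|mk].
  by move: ha; rewrite mem_iota.
by exists (m, i); split => //=; rewrite ?mem_iota ?mem_enum.
Qed.

Lemma uniq_past_index k : uniq (past_index k).
Proof.
apply: allpairs_uniq; rewrite ?iota_uniq ?enum_uniq//.
by move=> [a b] [a' b'] _ _ [-> ->].
Qed.

(* A pi-system generating the sigma-algebra of the seeds of the first [k] iterations. *)
Definition past (k : nat) : set (set Omega) :=
  [set A | exists2 B : nat * 'I_n -> set Xi, (forall m, measurable (B m)) &
    A = \bigcap_(m in [set` past_index k]) xi m.1 m.2 @^-1` B m].

Lemma past_setI k : setI_closed (past k).
Proof.
move=> _ _ [B mB ->] [B' mB' ->]; exists (fun m => B m `&` B' m).
  by move=> m; exact: measurableI.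
by rewrite -bigcapI.
Qed.

Lemma past_setT k : past k setT.
Proof.
exists (fun=> setT) => //.
by apply/seteqP; split.
Qed.

Lemma past_measurable k : past k `<=` measurable.
Proof.
have [mxi _ _] := hxi.
move=> _ [B mB ->]; apply: fin_bigcap_measurable; first exact: finite_seq.
by move=> m _; rewrite -[X in measurable X]setTI; apply: mxi.
Qed.

Lemma past_seed k m i : (m < k)%N ->
  measurable_fun [set: g_sigma_algebraType (past k)] (xi m i : g_sigma_algebraType (past k) -> Xi).
Proof.
move=> mk _ B mB; rewrite setTI; apply: sub_sigma_algebra.
exists (fun l => if l == (m, i) then B else setT).
  by move=> l; case: ifP.
apply/seteqP; split => [w /= wB l _|w /(_ (m, i))] /=.
  by case: ifP => // /eqP ->.
by rewrite eqxx; apply; rewrite /= mem_past_index.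
Qed.

(** For fixed [B] both sides are finite measures in [A]. They agree on the pi-system [past k] by
    mutual independence, hence on the sigma-algebra it generates. *)
Lemma past_indep k i (B : set Xi) (A : set Omega) : measurable B -> <<s past k >> A ->
  P (xi k i @^-1` B `&` A) = (mu B * P A)%E.
Proof.
have [mxi lawxi indxi] := hxi.
move=> mB.
have mxB : measurable (xi k i @^-1` B).
  by rewrite -[X in measurable X]setTI; apply: mxi.
pose r : {nonneg R} := NngNum (fine_ge0 (measure_ge0 mu B)).
have key := @g_sigma_algebra_measure_unique _ R Omega (past k) (@past_measurable k)
  (fun=> setT) (fun=> past_setT k) _ (mrestr P mxB) (mscale r P) (@past_setI k).
have nin : (k, i) \notin past_index k by rewrite mem_past_index ltnn.
have rP D : mscale r P D = (mu B * P D)%E.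
  by rewrite /mscale /r /= fineK// fin_num_measure.
move=> sA; rewrite setIC -rP -[LHS]/(mrestr P mxB A); apply: key => //.
- by rewrite bigcup_const.
- move=> _ [C mC ->]; rewrite -[RHS]/(mscale r P _) rP /= /mrestr.
  (* The event on the new seed is merged into the family, so that independence applies to the
     duplicate-free list [(k, i) :: past_index k]. *)
  pose C' l := if l == (k, i) then B else C l.
  have C'E l : l \in past_index k -> C' l = C l.
    by move=> lp; rewrite /C' ifF//; apply: contraNF nin => /eqP <-.
  have -> : \bigcap_(m in [set` past_index k]) xi m.1 m.2 @^-1` C m `&` xi k i @^-1` B =
     \bigcap_(m in [set` (k, i) :: past_index k]) xi m.1 m.2 @^-1` C' m.
    apply/seteqP; split => [w [wC wB] l|w wC] /=.
      rewrite inE => /orP[/eqP ->|lp]; first by rewrite /C' eqxx.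
      by rewrite C'E//; exact: wC.
    split.
      by move=> l lp; rewrite -C'E//; apply: wC; rewrite /= inE lp orbT.
    by have := wC (k, i); rewrite /= inE eqxx /C' eqxx; apply.
  have mC' l : measurable (C' l) by rewrite /C'; case: ifP.
  rewrite indxi//; last by rewrite /= nin uniq_past_index.
  rewrite big_cons /= {1}/C' eqxx lawxi// indxi ?uniq_past_index//.
  by congr (_ * _)%E; apply: eq_big_seq => l lp; rewrite C'E.
- move=> _; rewrite /= /mrestr setTI.
  by rewrite (le_lt_trans (probability_le1 _ _))// ltry.
Qed.

(* The seed of iteration [k] and the past are jointly distributed as [mu \x P], so Tonelli applies. *)
Lemma fresh_seed_integral_le k i (h : Xi * Omega -> \bar R) (C : R) :
  measurable_fun [set: Xi * g_sigma_algebraType (past k)] h ->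
  (forall z, 0 <= h z)%E ->
  (forall w, \int[mu]_u h (u, w) <= C%:E)%E ->
  (\int[P]_w h (xi k i w, w) <= C%:E)%E.
Proof.
have [mxi _ _] := hxi.
pose G := g_sigma_algebraType (past k).
move=> mh h0 hC.
have sub : <<s past k >> `<=` measurable.
  by apply: smallest_sub; [exact: sigma_algebra_measurable|exact: past_measurable].
pose toG : Omega -> G := id.
have mid : measurable_fun [set: Omega] toG.
  by move=> _ A mA; rewrite setTI; exact: sub.
pose jt (w : Omega) : Xi * G := (xi k i w, toG w).
have mjt : measurable_fun [set: Omega] jt by exact: measurable_fun_pair.
pose toGm := isMeasurableFun.Build _ _ _ _ toG mid.
pose toG' : {mfun Omega >-> G} := HB.pack toG toGm.
pose jtm := isMeasurableFun.Build _ _ _ _ jt mjt.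
pose jt' : {mfun Omega >-> (Xi * G)%type} := HB.pack jt jtm.
have rect A B : measurable A -> measurable B ->
    distribution P jt' (A `*` B) = (mu A * distribution P toG' B)%E.
  by move=> mA mB; exact: past_indep.
have -> : (\int[P]_w h (xi k i w, w) = \int[distribution P jt']_z h z)%E.
  by rewrite ge0_integral_distribution.
have -> : (\int[distribution P jt']_z h z = \int[mu \x distribution P toG']_z h z)%E.
  apply: eq_measure_integral => A mA _.
  by apply/esym; exact: (product_measure_unique rect).
rewrite fubini_tonelli2//.
apply: (@le_trans _ _ (\int[distribution P toG']_w (cst C%:E) w)%E).
  apply: ge0_le_integral => //.
  - by move=> w _; apply: integral_ge0.
  - exact: measurable_fun_fubini_tonelli_G.
  - by move=> w _; exact: hC.
by rewrite integral_cst//= /distribution /pushforward preimage_setT probability_setT mule1.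
Qed.

End Freshness.

(** * Compression noise *)

Section LpNorm.
Variables (R : realType) (d : nat) (p : R).
Hypothesis p_ge1 : 1 <= p.

Lemma norm_le_lpnorm (x : 'rV[R]_d) j : `|x ord0 j| <= lpnorm p x.
Proof.
have p0 : 0 < p by apply: lt_le_trans p_ge1.
rewrite -[leLHS]powRr1// -(@divff _ p) ?gt_eqF// powRrM.
have S0 : 0 <= \sum_(j < d) `|x ord0 j| `^ p by apply: sumr_ge0 => k _; exact: powR_ge0.
apply: ge0_ler_powR; rewrite ?nnegrE ?invr_ge0 ?powR_ge0 ?(ltW p0)//.
by rewrite (bigD1 j)//= lerDl sumr_ge0// => k _; exact: powR_ge0.
Qed.

(** Going through the largest coordinate treats all [p] at once, at the price of the factor [d]. *)
Lemma norm2_sqr_le_lpnorm (x : 'rV[R]_d) : norm2 x ^+ 2 <= d%:R * lpnorm p x ^+ 2.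
Proof.
rewrite norm2_sqr mdotE big_ord1.
apply: (@le_trans _ _ (\sum_(j < d) lpnorm p x ^+ 2)); last first.
  by rewrite sumr_const card_ord mulr_natl.
apply: ler_sum => j _; rewrite -expr2 -real_normK ?num_real//.
by rewrite ler_sqr ?nnegrE ?powR_ge0// norm_le_lpnorm.
Qed.

Lemma mvec_lpnorm {dT : measure_display} {T : measurableType dT} (X : T -> 'rV[R]_d) :
  mvec X -> measurable_fun [set: T] (fun w => lpnorm p (X w)).
Proof.
move=> mX; apply: (@measurableT_comp _ _ _ _ _ _ (@powR R ^~ p^-1)) => //.
apply: measurable_sum => j.
apply: (@measurableT_comp _ _ _ _ _ _ (@powR R ^~ p)) => //.
by apply: measurableT_comp => //; exact: mX.
Qed.

End LpNorm.

Section Noise.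
Context {R : realType} {n d : nat} {dX : measure_display} {Xi : measurableType dX}
  (mu : probability Xi R) {dO : measure_display} {Omega : measurableType dO}
  (P : probability Omega R) (xi : nat -> 'I_n -> Omega -> Xi).
Hypothesis hxi : fresh_seeds P mu xi.
Variables (cmp : Xi -> 'rV[R]_d -> 'rV[R]_d) (p C : R).
Hypotheses (hcmp : random_map cmp) (hp : 1 <= p)
  (hcomp : bounded_compression_error mu cmp p C).
Variables (L : 'M[R]_n) (f : 'I_n -> 'rV[R]_d -> R).
Hypothesis grad_cont : forall i j, continuous (fun x => gradient (f i) x ord0 j).
Variables (alpha beta eta : R) (s : nat -> R) (x0 : 'I_n -> 'rV[R]_d).
Variables (x xh y v q : nat -> 'I_n -> Omega -> 'rV[R]_d).
Hypothesis alg : algorithm3 L f cmp xi alpha beta eta s x0 x xh y v q.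

Lemma compression_error_norm2 (a : 'rV[R]_d) :
  (\int[mu]_u (norm2 (cmp u a - a) ^+ 2)%:E <= (d%:R * C)%:E)%E.
Proof.
have mY : mvec (fun u => cmp u a - a).
  apply: mvecB; last exact: mvec_cst.
  by apply: mvec_random_map => //; exact: mvec_cst.
have ml := mvec_lpnorm p mY.
apply: (@le_trans _ _ (\int[mu]_u (d%:R%:E * (lpnorm p (cmp u a - a) ^+ 2)%:E))%E).
  apply: ge0_le_integral => //.
  - by move=> u _; rewrite lee_fin sqr_ge0.
  - by apply/measurable_EFinP; exact: mvec_norm2_sqr.
  - by apply: measurable_funeM; apply/measurable_EFinP; exact: measurable_funX.
  - by move=> u _; rewrite -EFinM lee_fin norm2_sqr_le_lpnorm.
rewrite ge0_integralZl//.
- rewrite EFinM lee_wpmul2l// ?lee_fin//.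
  by have := hcomp a; rewrite unlock.
- by apply/measurable_EFinP; exact: measurable_funX.
- by move=> u _; rewrite lee_fin sqr_ge0.
Qed.

Lemma noise_integral_le k i : s k != 0 ->
  (\int[P]_w (norm2 (xh k i w - x k i w) ^+ 2)%:E <= (s k ^+ 2 * (d%:R * C))%:E)%E.
Proof.
move=> sk0.
pose G := g_sigma_algebraType (past xi k).
pose z (w : Omega) : 'rV[R]_d := (s k)^-1 *: (x k i w - Defs.prev xh k i w).
pose h (a : Xi * Omega) : \bar R := ((s k ^+ 2)%:E * (norm2 (cmp a.1 (z a.2) - z a.2) ^+ 2)%:E)%E.
have hE w : (norm2 (xh k i w - x k i w) ^+ 2)%:E = h (xi k i w, w).
  rewrite /h -EFinM (alg_xh alg) (alg_q alg) -/(z w) /= !norm2_sqr.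
  have -> : Defs.prev xh k i w + s k *: cmp (xi k i w) (z w) - x k i w =
      s k *: (cmp (xi k i w) (z w) - z w).
    by rewrite scalerBr {2}/z scalerA divff// scale1r opprB addrA (addrC (Defs.prev _ _ _ _)).
  by rewrite mdotZl mdotZr mulrA -expr2.
under eq_integral do rewrite hE.
(* Measurability is taken over [G], where [past_seed] supplies exactly the seeds of earlier
   iterations; this makes [z] a function of the past. *)
have [mx mxh _ _] : [/\ forall i, mvec (x k i : G -> _), forall i, mvec (Defs.prev xh k i : G -> _),
      forall i, mvec (Defs.prev y k i : G -> _) & forall i, mvec (v k i : G -> _)].
  by apply: (@algorithm3_measurable _ Xi R n d cmp hcmp f grad_cont _ G L xi _ _ _ _ _ _ _ _ _ _ alg);
    move=> m j mk; exact: past_seed.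
have mz : mvec (z : G -> _) by apply: mvecZ; exact: mvecB.
have mz2 : mvec (fun a : Xi * G => z a.2).
  by move=> j; apply: (measurableT_comp (mz j)); exact: measurable_snd.
have mn : measurable_fun [set: Xi * G] (fun a => norm2 (cmp a.1 (z a.2) - z a.2) ^+ 2).
  apply: mvec_norm2_sqr; apply: mvecB => //.
  by apply: mvec_random_map => //; exact: measurable_fst.
apply: (fresh_seed_integral_le hxi).
- by apply: measurable_funeM; apply/measurable_EFinP.
- by move=> a; rewrite mule_ge0 ?lee_fin ?sqr_ge0.
- move=> w; rewrite /h/= ge0_integralZl_EFin//.
  + by rewrite [leRHS]EFinM lee_wpmul2l ?lee_fin ?sqr_ge0//; exact: compression_error_norm2.
  + by move=> u _; rewrite lee_fin sqr_ge0.
  + apply/measurable_EFinP; apply: mvec_norm2_sqr; apply: mvecB; last exact: mvec_cst.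
    by apply: mvec_random_map => //; exact: mvec_cst.
  + by rewrite sqr_ge0.
Qed.

End Noise.

(** * Descent along a trajectory *)

(** Polarization, encoded in the premise with [g - 2 * m + N], replaces [- eta m] by
    [- eta / 2 (g + N)] plus [eta Lf^2 X / 2], which cancels the surplus of [lyap_descent]. Of the
    gain in [g], 1/8 meets the drift and the remaining 3/8 is dropped. *)
Lemma descent_combine (R : realType) (eta Lf E1 T2 E3 T4 E5 E6 : R)
    (W' W F' F X U g N m ne nE : R) :
  W' <= W - eta * (E1 + Lf ^+ 2 / 2 - eta * T2) * X - eta * (E3 - eta * T4) * U
    + eta * (1 / 8 - E5 + eta * (E6 - Lf / 2)) * g + ne ->
  F' <= F - eta * m + Lf / 2 * eta ^+ 2 * g -> ne <= nE ->
  0 <= eta * (Lf ^+ 2 * X - (g - 2 * m + N)) ->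
  0 <= eta * (E3 - eta * T4) * U -> 0 <= eta * (E5 - eta * E6) * g -> 0 <= eta * g ->
  W' + F' <= W + F - eta * (E1 - eta * T2) * X - eta / 2 * N + nE.
Proof. lra. Qed.

Section Trajectory.
Context {R : realType} {n d : nat} {Omega Xi : Type}.
Variable A : 'M[R]_n.
Hypotheses (hn : (2 <= n)%N) (hA : weighted_adjacency A) (hconn : connected_graph A).
Let L := laplacian A.
Let K := cent_mx R n.
Let J := avg_mx R n.
Let rho2 := least_pos_eigenvalue L.
Let rho := spectral_radius L.
Variables (f : 'I_n -> 'rV[R]_d -> R) (Lf : R).
Hypotheses (hLf : 0 < Lf) (hdiff : forall i x, differentiable (f i) x).
Hypothesis hlip : forall i x y,
  norm2 (gradient (f i) x - gradient (f i) y) <= Lf * norm2 (x - y).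
Variables (cmp : Xi -> 'rV[R]_d -> 'rV[R]_d) (xi : nat -> 'I_n -> Omega -> Xi).
Variables (k1 alpha beta eta : R) (s : nat -> R) (x0 : 'I_n -> 'rV[R]_d).
Variables (x xh y v q : nat -> 'I_n -> Omega -> 'rV[R]_d).
Hypothesis alg : algorithm3 L f cmp xi alpha beta eta s x0 x xh y v q.
Hypotheses (alphaE : alpha = k1 * beta) (eta_gt0 : 0 < eta) (beta_gt0 : 0 < beta)
  (k1_ge1 : 1 <= k1) (hk1 : 9 / 2 <= k1 * rho2) (hbeta : 6 <= beta * rho2)
  (heta2 : eta * teps4 L beta < eps3 L beta)
  (heta3 : eta * eps6 L Lf alpha beta < eps5 L Lf alpha beta).
Variable Q : 'M[R]_n.
Hypotheses (QT : Q^T = Q) (LQ : L *m Q = K) (QL : Q *m L = K) (QK : Q *m K = Q).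

Let n_gt0 : (0 < n)%N := ltnW hn.
Let rho2_gt0 : 0 < rho2 := least_pos_eigenvalue_gt0 hn hA hconn.

Lemma algorithm3_y k i w : y k i w = xh k i w - \sum_j L i j *: xh k j w.
Proof.
have py m : Defs.prev y m i w = Defs.prev xh m i w - \sum_j L i j *: Defs.prev xh m j w ->
    y m i w = xh m i w - \sum_j L i j *: xh m j w.
  rewrite (alg_y alg) (alg_xh alg) => ->.
  under [X in _ = _ - X]eq_bigr => j _.
    rewrite (alg_xh alg) scalerDr scalerA (mulrC (L i j)) -scalerA; over.
  by rewrite big_split/= -scaler_sumr opprD [RHS]addrACA addrA.
elim: k => [|k IHk]; apply: py => //=.
by rewrite big1 ?subrr// => j _; rewrite scaler0.
Qed.

Variable w : Omega.
Let X k : 'M[R]_(n, d) := \matrix_i x k i w.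
Let H k : 'M[R]_(n, d) := \matrix_i xh k i w.
Let V k : 'M[R]_(n, d) := \matrix_i v k i w.
Let xbar k := average (fun i => x k i w).
Let G k : 'M[R]_(n, d) := \matrix_i gradient (f i) (x k i w).
Let G0 k : 'M[R]_(n, d) := \matrix_i gradient (f i) (xbar k).

Lemma row_mul_sum m (B : 'M[R]_(m, n)) (M : 'M[R]_(n, d)) i :
  row i (B *m M) = \sum_j B i j *: row j M.
Proof. by rewrite row_mul mulmx_sum_row; apply: eq_bigr => j _; rewrite mxE. Qed.

Let xhy k : \matrix_i (xh k i w - y k i w) = L *m H k.
Proof.
apply/row_matrixP => i; rewrite rowK row_mul_sum algorithm3_y opprB addrC subrK.
by apply: eq_bigr => j _; rewrite rowK.
Qed.

Let X_step k : X k.+1 = X k - (eta * alpha) *: (L *m H k) - eta *: (beta *: V k + G k).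
Proof.
by rewrite -xhy; apply/matrixP => i j; rewrite !mxE (alg_x alg) !mxE.
Qed.

Let V_step k : V k.+1 = V k + (eta * beta) *: (L *m H k).
Proof.
by rewrite -xhy; apply/matrixP => i j; rewrite !mxE (alg_v alg) !mxE.
Qed.

Let JL : J *m L = 0 := avg_laplacian hA.
Let LJ : L *m J = 0 := laplacian_avg A.
Let KL : K *m L = L. Proof. by rewrite /K /cent_mx mulmxBl mul1mx -/J JL subr0. Qed.
Let LK : L *m K = L. Proof. by rewrite /K /cent_mx mulmxBr mulmx1 -/J LJ subr0. Qed.
Let KK M : K *m (K *m M) = K *m M :> 'M[R]_(n, d).
Proof. by rewrite mulmxA cent_mx_idem. Qed.

(** The dual variable starts at 0 and moves only in the range of [L]. Consequently neither the dual
    variable nor the compression noise enters the recursion of the average iterate. *)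
Let JV k : J *m V k = 0.
Proof.
elim: k => [|k IHk]; last by rewrite V_step mulmxDr IHk -scalemxAr mulmxA JL mul0mx scaler0 addr0.
rewrite (_ : V 0%N = 0) ?mulmx0//.
by apply/row_matrixP => i; rewrite rowK (alg_v0 alg) row0.
Qed.

Let KV k : K *m V k = V k.
Proof. by rewrite /K /cent_mx mulmxBl mul1mx -/J JV subr0. Qed.

Let gbar k := average (fun i => gradient (f i) (x k i w)).

Let row_avg k i : row i (J *m X k) = xbar k.
Proof. by rewrite row_avg_mx; congr average; apply/funext => j; rewrite rowK. Qed.

Let xbar_step k : xbar k.+1 = xbar k - eta *: gbar k.
Proof.
have i0 : 'I_n := Ordinal n_gt0.
rewrite -(row_avg k.+1 i0) -(row_avg k i0) X_step.
rewrite !(mulmxBr, mulmxDr) -!scalemxAr mulmxDr -scalemxAr JV scaler0 add0r.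
rewrite mulmxA JL mul0mx scaler0 subr0 linearB linearZ/= (row_avg_mx (G k)).
by congr (_ - _ *: average _); apply/funext => j; rewrite rowK.
Qed.

Let pE k : mdot (K *m X k) (K *m X k) = \sum_i norm2 (x k i w - xbar k) ^+ 2.
Proof.
have xbarE : average (fun i => row i (X k)) = xbar k.
  by congr average; apply/funext => j; rewrite rowK.
by rewrite mdot_rows; apply: eq_bigr => i _; rewrite norm2_sqr row_cent_mx rowK xbarE.
Qed.

(** [u] measures the dual error against the moving target [- K g / beta]; [h] is the gradient
    mismatch caused by disagreement, and [dl] is the displacement of the target during one step. *)
Let p := fun k => K *m X k.
Let u := fun k => K *m (V k + beta^-1 *: G0 k).
Let e := fun k => K *m (H k - X k).
Let h := fun k => K *m (G k - G0 k).
Let dl := fun k => K *m (beta^-1 *: (G0 k.+1 - G0 k)).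

Let LpE k : L *m (p k + e k) = L *m H k.
Proof. by rewrite /p /e -mulmxDr addrC subrK mulmxA LK. Qed.

Let p_step k : p k.+1 = p k - eta *: (alpha *: (L *m (p k + e k)) + beta *: u k + h k).
Proof.
rewrite LpE /p X_step /u /h !(mulmxBr, mulmxDr) -!scalemxAr mulmxA KL.
rewrite !mulmxDr -!scalemxAr KV.
move: (K *m X k) (L *m H k) (V k) (K *m G k) (K *m G0 k) => M1 M2 M3 M4 M5.
by apply/matrixP => i j; rewrite !mxE; field; rewrite gt_eqF.
Qed.

Let u_step k : u k.+1 = u k + (eta * beta) *: (L *m (p k + e k)) + dl k.
Proof.
rewrite LpE /u /dl V_step -!scalemxAr !(mulmxBr, mulmxDr) -!scalemxAr.
rewrite mulmxA KL !scalerBr.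
move: (L *m H k) (K *m V k) (K *m G0 k) (K *m G0 k.+1) => M1 M2 M3 M4.
by apply/matrixP => i j; rewrite !mxE; ring.
Qed.

Let lip_sqr i a b :
  mdot (gradient (f i) a - gradient (f i) b) (gradient (f i) a - gradient (f i) b) <=
  Lf ^+ 2 * mdot (a - b) (a - b).
Proof.
have := hlip i a b; rewrite -(@ler_sqr _ (norm2 _)) ?nnegrE ?sqrtr_ge0//; last first.
  by rewrite mulr_ge0 ?sqrtr_ge0// ltW.
by rewrite exprMn !norm2_sqr.
Qed.

Let GG0_le k : mdot (G k - G0 k) (G k - G0 k) <= Lf ^+ 2 * mdot (p k) (p k).
Proof.
rewrite /p pE mdot_rows mulr_sumr; apply: ler_sum => i _.
by rewrite linearB/= !rowK norm2_sqr lip_sqr.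
Qed.

Let h_le k : mdot (h k) (h k) <= Lf ^+ 2 * mdot (p k) (p k).
Proof. by rewrite (le_trans _ (GG0_le k))// mdot_cent_le. Qed.

Let g k := n%:R * mdot (gbar k) (gbar k).

(** Every agent evaluates its gradient at the same average point, which moves by [- eta gbar];
    Lipschitz continuity then gives the same bound on each of the [n] rows. *)
Let dl_le k : mdot (dl k) (dl k) <= eta ^+ 2 * (Lf ^+ 2 * g k) / beta ^+ 2.
Proof.
rewrite /dl (le_trans (mdot_cent_le n_gt0 _))// mdotZl mdotZr mulrA -expr2 exprVn mulrC.
rewrite ler_pM2r ?invr_gt0 ?exprn_gt0// mdot_rows.
have -> : eta ^+ 2 * (Lf ^+ 2 * g k) =
    \sum_(i < n) Lf ^+ 2 * mdot (xbar k.+1 - xbar k) (xbar k.+1 - xbar k).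
  rewrite sumr_const card_ord -[RHS]mulr_natr xbar_step addrAC subrr add0r.
  rewrite mdotNl mdotNr opprK mdotZl mdotZr /g; ring.
by apply: ler_sum => i _; rewrite linearB/= !rowK lip_sqr.
Qed.

Let F k := \sum_i f i (xbar k).
Let gm k := gradient (mean_fun f) (xbar k).

Let sum_gradient k : \sum_i gradient (f i) (xbar k) = n%:R *: gm k.
Proof.
rewrite /gm gradient_mean_fun// /average scalerA divff ?scale1r//.
by rewrite pnatr_eq0 -lt0n.
Qed.

Let F_step k : F k.+1 <= F k - eta * (n%:R * mdot (gm k) (gbar k)) + Lf / 2 * eta ^+ 2 * g k.
Proof.
rewrite /F /g xbar_step; move: (gbar k) => b.
have -> : \sum_i f i (xbar k) - eta * (n%:R * mdot (gm k) b) +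
      Lf / 2 * eta ^+ 2 * (n%:R * mdot b b) =
   \sum_i (f i (xbar k) + mdot (gradient (f i) (xbar k)) (- (eta *: b)) +
     Lf / 2 * mdot (- (eta *: b)) (- (eta *: b))).
  rewrite !big_split/= sumr_const card_ord -[X in _ = _ + X]mulr_natr.
  have -> : \sum_i mdot (gradient (f i) (xbar k)) (- (eta *: b)) =
      mdot (\sum_i gradient (f i) (xbar k)) (- (eta *: b)).
    apply: (big_ind2 (fun t z => t = mdot z (- (eta *: b)))) => //.
      by rewrite mdotC mdot0r.
    by move=> t z t' z' -> ->; rewrite mdotDl.
  rewrite sum_gradient; move: (gm k) => m.
  rewrite !(mdotNl, mdotNr, mdotZl, mdotZr); ring.
by apply: ler_sum => i _; exact: descent_lemma.
Qed.

(** [gbar - grad f] is the common row of [J (G - G0)], and averaging does not increase the Frobenius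
    norm. *)
Let mean_gap k : n%:R * mdot (gbar k - gm k) (gbar k - gm k) <= Lf ^+ 2 * mdot (p k) (p k).
Proof.
have rowE i : row i (J *m (G k - G0 k)) = gbar k - gm k.
  rewrite row_avg_mx /gm gradient_mean_fun// /gbar /average -scalerBr -sumrB.
  by congr (_ *: _); apply: eq_bigr => j _; rewrite linearB/= !rowK.
apply: le_trans (GG0_le k); apply: le_trans (mdot_avg_le n_gt0 _).
rewrite [leRHS]mdot_rows (eq_bigr (fun=> mdot (gbar k - gm k) (gbar k - gm k))) => [|i _].
  by rewrite sumr_const card_ord; move: (mdot _ _) => m; rewrite mulr_natl.
by rewrite rowE.
Qed.

Definition lyapunov k : R := lyap Q (k1 + 1) (p k) (u k) + F k.

Lemma lyapunov_step k : lyapunov k.+1 <= lyapunov k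
  - eta * (eps1 L Lf alpha beta - eta * teps2 L Lf alpha beta) *
      \sum_i norm2 (x k i w - xbar k) ^+ 2
  - eta / 2 * (n%:R * norm2 (gm k) ^+ 2)
  + noise_coef rho eta alpha beta k1 * \sum_i norm2 (xh k i w - x k i w) ^+ 2.
Proof.
rewrite -pE norm2_sqr.
have rho_gt0 : 0 < rho.
  exact: lt_le_trans rho2_gt0 (least_pos_eigenvalue_le_radius hn hA hconn).
have k1_gt0 : 0 < k1 by apply: lt_le_trans k1_ge1.
have noise0 : 0 <= noise_coef rho eta alpha beta k1.
  by rewrite noise_coef_ge0 ?alphaE ?mulr_ge0// ltW.
have eE : mdot (e k) (e k) <= \sum_i norm2 (xh k i w - x k i w) ^+ 2.
  rewrite (le_trans (mdot_cent_le n_gt0 _))// mdot_rows le_eqVlt; apply/orP; left; apply/eqP.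
  by apply: eq_bigr => i _; rewrite linearB/= !rowK norm2_sqr.
have hE := ler_wpM2l noise0 eE.
have hD := @lyap_descent R n d L Q K rho rho2 (laplacian_tr hA) QT LQ QL QK (cent_mx_tr R n)
  rho2_gt0 (least_pos_eigenvalue_le_radius hn hA hconn)
  (@laplacian_gap R n A hn hA hconn d) (@laplacian_mx_psd R n A hA d)
  (@laplacian_radius R n A hn hA d)
  (k1 + 1) k1 eta alpha beta Lf (g k) (p k) (e k) (u k) (h k) (dl k)
  alphaE erefl eta_gt0 beta_gt0 k1_ge1 hk1 hbeta (KK _) (KK _) (KK _) (KK _) (h_le k) (dl_le k).
rewrite -p_step -u_step in hD.
have U0 : 0 <= mdot (u k) (Q *m u k).
  exact: (mulQ_ge0 (laplacian_tr hA) LQ rho2_gt0 (least_pos_eigenvalue_le_radius hn hA hconn)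
    (@laplacian_mx_psd R n A hA d) (@laplacian_radius R n A hn hA d) (KK _)).
have hF := F_step k.
have g0 : 0 <= g k by rewrite mulr_ge0// mdot_ge0.
have hM : 0 <= eta * (Lf ^+ 2 * mdot (p k) (p k) -
    (g k - 2 * (n%:R * mdot (gm k) (gbar k)) + n%:R * mdot (gm k) (gm k))).
  apply: mulr_ge0; first exact: ltW.
  rewrite subr_ge0; apply: le_trans (mean_gap k); rewrite /g.
  move: (gbar k) (gm k) => b m.
  rewrite !(mdotDl, mdotDr, mdotNl, mdotNr) opprK (mdotC b m) le_eqVlt.
  by apply/orP; left; apply/eqP; ring.
have hU : 0 <= eta * (eps3 L beta - eta * teps4 L beta) * mdot (u k) (Q *m u k).
  by rewrite mulr_ge0// mulr_ge0 ?subr_ge0 ?(ltW eta_gt0) ?(ltW heta2).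
have hG : 0 <= eta * (eps5 L Lf alpha beta - eta * eps6 L Lf alpha beta) * g k.
  by rewrite mulr_ge0// mulr_ge0 ?subr_ge0 ?(ltW eta_gt0) ?(ltW heta3).
have hg : 0 <= eta * g k by rewrite mulr_ge0// ltW.
(* [k1 + 1] is [(alpha + beta) / beta], which turns the powers 3 and 2 of [beta] into the 5 and 3 of
   [eps5] and [eps6]. *)
have e5 : eta * ((k1 + 1) ^+ 2 * Lf ^+ 2 / (beta ^+ 3 * rho2) +
    Lf ^+ 2 / (2 * beta ^+ 2 * rho2 ^+ 2) +
    eta * ((k1 + 1) * Lf ^+ 2 / (2 * beta ^+ 2 * rho2) + 3 * Lf ^+ 2 / 4 +
      Lf ^+ 2 / (2 * beta ^+ 2 * rho2 ^+ 2))) * g k =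
  eta * (1 / 8 - eps5 L Lf alpha beta + eta * (eps6 L Lf alpha beta - Lf / 2)) * g k.
  by rewrite /eps5 /eps6 -/rho2 alphaE; field; rewrite !gt_eqF.
rewrite e5 in hD.
have e1 : alpha / 2 * rho2 - 1 / 4 * (9 * beta + 4 + 5 * Lf ^+ 2) = eps1 L Lf alpha beta by [].
have e2 : 3 * Lf ^+ 2 + 2 * beta ^+ 2 + 1 + 3 * alpha ^+ 2 * rho ^+ 2 = teps2 L Lf alpha beta by [].
have e3 : beta / 2 - 3 / rho2 = eps3 L beta by [].
have e4 : 2 * beta ^+ 2 * rho + rho2^-1 = teps4 L beta by [].
rewrite e1 e2 e3 e4 in hD.
exact: (descent_combine hD hF hE hM hU hG hg).
Qed.

Lemma lyapunov_ge k : n%:R * mean_fun f (xbar k) <= lyapunov k.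
Proof.
rewrite /lyapunov /mean_fun mulrA divff ?mul1r; last by rewrite pnatr_eq0 -lt0n.
rewrite lerDr.
apply: (lyap_ge0 (laplacian_tr hA) QT LQ QK (cent_mx_tr R n) rho2_gt0
  (least_pos_eigenvalue_le_radius hn hA hconn) (@laplacian_gap R n A hn hA hconn d)
  (@laplacian_mx_psd R n A hA d) (@laplacian_radius R n A hn hA d) _ _ (KK _)).
(* The condition of [lyap_ge0] reads [(k1 + 1) rho2 >= 1], well within [k1 rho2 >= 9/2]. *)
rewrite -(ler_pM2r rho2_gt0) mulVf ?gt_eqF// mulrDl mul1r.
have := hk1; have := rho2_gt0; lra.
Qed.

End Trajectory.

(** * Bounds in expectation *)

Lemma sum_geometric_le (R : realType) (g : R) T : 0 < g < 1 ->
  \sum_(0 <= k < T) g ^+ k <= (1 - g)^-1.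
Proof.
move=> /andP[g0 g1]; have g1' : 0 < 1 - g by rewrite subr_gt0.
rewrite big_mkord -[leRHS]mul1r ler_pdivlMr// mulrC -[_ * _]opprK -mulNr opprB -subrX1 opprB.
by rewrite gerBl exprn_ge0// ltW.
Qed.

(** 9/2 is what remains of [(9 + kappa4) / 2] once [kappa4 > 0] is dropped, and 6 is the branch
    [6 / rho2] of [kappa5]. *)
Lemma kappa_bounds (R : realType) n (L : 'M[R]_n) (Lf k1 k4 beta : R) :
  0 < least_pos_eigenvalue L -> 0 < k4 -> kappa1_bound L k4 <= k1 ->
  kappa2 L Lf k1 k4 < beta ->
  [/\ 0 < beta, 1 <= k1, 9 / 2 <= k1 * least_pos_eigenvalue L &
      6 <= beta * least_pos_eigenvalue L].
Proof.
move=> r0 k40; rewrite /kappa1_bound ge_max => /andP[h1 h2].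
rewrite /kappa2 gt_max => /andP[+ _]; rewrite /kappa5 gt_max => /andP[_ h3].
have b0 : 0 < beta by apply: lt_trans h3; rewrite divr_gt0.
split => //; last by rewrite -ler_pdivrMr// ltW.
move: h1; rewrite ler_pdivrMr ?mulr_gt0//; lra.
Qed.

Lemma tkappa3_bounds (R : realType) n (L : 'M[R]_n) (Lf k1 beta eta : R) :
  let alpha := k1 * beta in
  0 < least_pos_eigenvalue L -> 0 <= spectral_radius L -> 0 < Lf -> 0 < beta -> 0 < k1 ->
  eta < tkappa3 L Lf alpha beta ->
  [/\ eta * teps2 L Lf alpha beta < eps1 L Lf alpha beta,
      eta * teps4 L beta < eps3 L beta &
      eta * eps6 L Lf alpha beta < eps5 L Lf alpha beta].
Proof.
move=> alpha r0 rho0 Lf0 b0 k0; have a0 : 0 < alpha by rewrite mulr_gt0.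
have t2 : 0 < teps2 L Lf alpha beta.
  apply: ltr_wpDr; last by rewrite !addr_gt0 ?mulr_gt0 ?exprn_gt0.
  by apply: mulr_ge0; [apply: mulr_ge0 => //|]; exact: sqr_ge0.
have t4 : 0 < teps4 L beta.
  by rewrite /teps4 ltr_wpDl ?invr_gt0// mulr_ge0// mulr_ge0 ?sqr_ge0.
have t6 : 0 < eps6 L Lf alpha beta.
  by rewrite /eps6 !addr_gt0 ?divr_gt0 ?mulr_gt0 ?exprn_gt0 ?addr_gt0.
by rewrite /tkappa3 !lt_min !ltr_pdivlMr// => /and3P[].
Qed.

Lemma telescope_le (R : realType) (V S D : nat -> R) (delta c : R) :
  (forall k, V k.+1 <= V k - delta * S k + c * D k) ->
  forall T, V T + delta * \sum_(0 <= k < T) S k <= V 0%N + c * \sum_(0 <= k < T) D k.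
Proof.
move=> VS; elim=> [|T IHT]; first by rewrite !big_geq// !mulr0.
rewrite !big_nat_recr//= !mulrDr; have := VS T; lra.
Qed.

Lemma integral_affine_sum_le {dO : measure_display} {Omega : measurableType dO}
    {R : realType} (P : probability Omega R) n (N : nat -> 'I_n -> Omega -> R)
    (b : nat -> R) (a c : R) T :
  (forall k i, measurable_fun [set: Omega] (N k i)) -> (forall k i w, 0 <= N k i w) ->
  (forall k i, \int[P]_w (N k i w)%:E <= (b k)%:E)%E -> 0 <= a -> 0 <= c ->
  (\int[P]_w (a + c * \sum_(0 <= k < T) \sum_i N k i w)%:E <=
    (a + c * (n%:R * \sum_(0 <= k < T) b k))%:E)%E.
Proof.
move=> mN N0 Nb a0 c0.
have mNE k i : measurable_fun [set: Omega] (fun w => (N k i w)%:E).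
  exact/measurable_EFinP.
under eq_integral => w _.
  rewrite EFinD EFinM -sumEFin.
  under eq_bigr do rewrite -sumEFin.
  over.
have mS k : measurable_fun [set: Omega] (fun w => \sum_(i < n) (N k i w)%:E)%E.
  exact: emeasurable_sum.
have S0 k w : (0 <= \sum_(i < n) (N k i w)%:E)%E.
  by apply: sume_ge0 => i _; rewrite lee_fin.
have mSS : measurable_fun [set: Omega] (fun w => \sum_(0 <= k < T) \sum_(i < n) (N k i w)%:E)%E.
  exact: emeasurable_sum.
have SS0 w : (0 <= \sum_(0 <= k < T) \sum_(i < n) (N k i w)%:E)%E.
  by apply: sume_ge0 => k _.
rewrite ge0_integralD//; last 2 first.
  by move=> w _; rewrite mule_ge0.
  exact: measurable_funeM.
rewrite integral_cst//= probability_setT mule1 ge0_integralZl//.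
rewrite [leRHS]EFinD leeD2l// [leRHS]EFinM lee_wpmul2l ?lee_fin//.
rewrite ge0_integral_sum// mulr_sumr -sumEFin; apply: lee_sum => k _.
rewrite ge0_integral_sum//; last by move=> i w _; rewrite lee_fin.
apply: (@le_trans _ _ (\sum_(i < n) (b k)%:E)%E); first by apply: lee_sum.
by rewrite sumEFin sumr_const card_ord mulr_natl.
Qed.

Unset Implicit Arguments.

Theorem theorem5 (R : realType) (n d : nat) (hn : (2 <= n)%N) (hd : (1 <= d)%N)
  (A : 'M[R]_n) (hA : weighted_adjacency A) (hconn : connected_graph A)
  (f : 'I_n -> 'rV[R]_d -> R) (Lf : R) (hLf : 0 < Lf)
  (hdiff : forall i x, differentiable (f i) x)
  (hlip : forall i x y,
     norm2 (gradient (f i) x - gradient (f i) y) <= Lf * norm2 (x - y))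
  (fstar : R) (hfstar : is_minimum (mean_fun f) fstar)
  (dX : measure_display) (Xi : measurableType dX) (mu : probability Xi R)
  (cmp : Xi -> 'rV[R]_d -> 'rV[R]_d) (hcmp : random_map cmp)
  (p C : R) (hp : 1 <= p) (hC : 0 <= C)
  (hcomp : bounded_compression_error mu cmp p C)
  (dO : measure_display) (Omega : measurableType dO) (P : probability Omega R)
  (xi : nat -> 'I_n -> Omega -> Xi) (hxi : fresh_seeds P mu xi)
  (kappa1 kappa4 alpha beta eta s0 gamma : R)
  (hkappa4 : 0 < kappa4)
  (hkappa1 : kappa1_bound (laplacian A) kappa4 <= kappa1)
  (halpha : alpha = kappa1 * beta)
  (hbeta : kappa2 (laplacian A) Lf kappa1 kappa4 < beta)
  (heta : 0 < eta < tkappa3 (laplacian A) Lf alpha beta)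
  (hs0 : 0 < s0) (hgamma : 0 < gamma < 1)
  (x0 : 'I_n -> 'rV[R]_d)
  (x xh y v q : nat -> 'I_n -> Omega -> 'rV[R]_d)
  (halg : algorithm3 (laplacian A) f cmp xi alpha beta eta
            (fun k => s0 * gamma ^+ k) x0 x xh y v q) :
  let xbar k w := average (fun i => x k i w) in
  bigO1 (fun T => \sum_(0 <= k < T.+1) \sum_(i < n)
    'E_P[fun w => (norm2 (x k i w - xbar k w) ^+ 2
                   + norm2 (gradient (mean_fun f) (xbar k w)) ^+ 2)%R])%E /\
  bigO1 (fun T => 'E_P[fun w => (mean_fun f (xbar T w) - fstar)%R])%E.
Proof.
move=> xbar.
have n0 : (0 < n)%N by exact: ltnW.
have n0R : 0 < n%:R :> R by rewrite ltr0n.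
pose L := laplacian A.
have rho2_gt0 : 0 < least_pos_eigenvalue L by exact: least_pos_eigenvalue_gt0.
have rho_ge0 : 0 <= spectral_radius L.
  by rewrite ltW// (lt_le_trans rho2_gt0)// least_pos_eigenvalue_le_radius.
have [b0 k1_ge1 hk1 hb] := kappa_bounds rho2_gt0 hkappa4 hkappa1 hbeta.
have k1_gt0 : 0 < kappa1 by apply: lt_le_trans k1_ge1.
case/andP: heta => eta0; rewrite halpha => heta.
have [he1 he2 he3] := tkappa3_bounds rho2_gt0 rho_ge0 hLf b0 k1_gt0 heta.
rewrite -halpha in he1 he2 he3.
have [Q [QT LQ QL QK]] := laplacian_pinv hn hA hconn.
have [_ fmin] := hfstar.
have grad_cont i j : continuous (fun z => gradient (f i) z ord0 j).
  by apply: gradient_entry_continuous hLf _ => a b; exact: hlip.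
have [mxi _ _] := hxi.
have mx k i : mvec (x k i).
  by have [h _ _ _] := algorithm3_measurable hcmp grad_cont halg (fun m i (_ : (m < k)%N) => mxi m i); exact: h.
(* [prev xh k.+1] computes to [xh k], hence the use of the seeds up to time [k] included. *)
have mxh k i : mvec (xh k i).
  by have [_ h _ _] := algorithm3_measurable hcmp grad_cont halg (fun m i (_ : (m < k.+1)%N) => mxi m i); exact: h.
have mxbar k : mvec (xbar k) by apply: mvecZ; exact: mvec_sum.
have mgrad k : mvec (fun w => gradient (mean_fun f) (xbar k w)).
  under eq_fun do rewrite gradient_mean_fun//.
  apply: mvecZ; apply: mvec_sum => i j.
  exact: (mvec_continuous (mxbar k) (@grad_cont i j)).
pose V k w := lyapunov f kappa1 beta x v Q w k.
pose N k i w := norm2 (xh k i w - x k i w) ^+ 2.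
pose S k w := \sum_i (norm2 (x k i w - xbar k w) ^+ 2 +
  norm2 (gradient (mean_fun f) (xbar k w)) ^+ 2).
have mN k i : measurable_fun [set: Omega] (N k i).
  by apply: mvec_norm2_sqr; exact: mvecB.
have N0 k i w : 0 <= N k i w by rewrite sqr_ge0.
pose cE := noise_coef (spectral_radius L) eta alpha beta kappa1.
have cE0 : 0 <= cE.
  by rewrite noise_coef_ge0 ?halpha ?mulr_ge0 ?(ltW eta0) ?(ltW b0) ?(ltW k1_gt0).
(* The minimum gives consensus error and gradient a common rate, so that a single sum [S] is
   telescoped. *)
pose del := Num.min (eta * (eps1 L Lf alpha beta - eta * teps2 L Lf alpha beta)) (eta / 2).
have del0 : 0 < del by rewrite lt_min !mulr_gt0 ?subr_gt0 ?invr_gt0.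
have Vstep k w : V k.+1 w <= V k w - del * S k w + cE * \sum_i N k i w.
  have := lyapunov_step hn hA hconn hLf hdiff hlip halg halpha eta0 b0 k1_ge1 hk1 hb
    he2 he3 QT LQ QL QK w k.
  rewrite -/(V k w) -/(V k.+1 w) -/cE => hV.
  rewrite /S big_split/= sumr_const card_ord -[_ *+ n]mulr_natl mulrDr.
  have i1 : del * (\sum_i norm2 (x k i w - xbar k w) ^+ 2) <=
      eta * (eps1 L Lf alpha beta - eta * teps2 L Lf alpha beta) *
      (\sum_i norm2 (x k i w - xbar k w) ^+ 2).
    by apply: ler_wpM2r; [apply: sumr_ge0 => i _; rewrite sqr_ge0|rewrite ge_min lexx].
  have i2 : del * (n%:R * norm2 (gradient (mean_fun f) (xbar k w)) ^+ 2) <=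
      eta / 2 * (n%:R * norm2 (gradient (mean_fun f) (xbar k w)) ^+ 2).
    by apply: ler_wpM2r; [rewrite mulr_ge0 ?sqr_ge0|rewrite ge_min lexx orbT].
  apply: (le_trans hV); rewrite lerD2r opprD addrA.
  by apply: lerB => //; exact: lerB.
have Vge k w : n%:R * mean_fun f (xbar k w) <= V k w.
  exact: (lyapunov_ge hn hA hconn f beta x v hk1 QT LQ QK w k).
(* The initial data are deterministic, so the initial Lyapunov value can be read at the arbitrary
   sample [point] and stays a constant under the integral. *)
have V0E w : V 0%N w = V 0%N point.
  rewrite /V /lyapunov.
  have -> : \matrix_i x 0%N i w = \matrix_i x 0%N i point.
    by apply/matrixP => i j; rewrite !mxE !(alg_x0 halg).
  have -> : \matrix_i v 0%N i w = \matrix_i v 0%N i point.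
    by apply/matrixP => i j; rewrite !mxE !(alg_v0 halg).
  have -> : (fun i => x 0%N i w) = (fun i => x 0%N i point) => //.
  by apply/funext => i; rewrite !(alg_x0 halg).
pose B := V 0%N point - n%:R * fstar.
have B0 : 0 <= B.
  by rewrite subr_ge0 (le_trans _ (Vge 0%N point))// ler_pM2l.
(* Subtracting [n fstar] makes both summands on the left nonnegative, so this one inequality bounds
   each of them separately. *)
have main T w : n%:R * (mean_fun f (xbar T w) - fstar) + del * \sum_(0 <= k < T) S k w <=
    B + cE * \sum_(0 <= k < T) \sum_i N k i w.
  have := telescope_le (V := V ^~ w) (fun k => Vstep k w) T.
  rewrite V0E /B; have := Vge T w; lra.
have S0 k w : 0 <= S k w by apply: sumr_ge0 => i _; rewrite addr_ge0 ?sqr_ge0.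
have f0 T w : 0 <= mean_fun f (xbar T w) - fstar by rewrite subr_ge0.
have s_gt0 k : 0 < s0 * gamma ^+ k.
  by case/andP: hgamma => g0 _; rewrite mulr_gt0 ?exprn_gt0.
have NI k i : (\int[P]_w (N k i w)%:E <= ((s0 * gamma ^+ k) ^+ 2 * (d%:R * C))%:E)%E.
  by apply: (noise_integral_le hxi hcmp hp hcomp grad_cont halg); rewrite gt_eqF.
have sum_s T : \sum_(0 <= k < T) (s0 * gamma ^+ k) ^+ 2 * (d%:R * C) <=
    s0 ^+ 2 * (1 - gamma)^-1 * (d%:R * C).
  rewrite -mulr_suml ler_wpM2r ?mulr_ge0//.
  (* One factor [gamma ^+ k] of the square is bounded by 1, which leaves a geometric series of ratio
     [gamma]. *)
  apply: (@le_trans _ _ (\sum_(0 <= k < T) s0 ^+ 2 * gamma ^+ k)); last first.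
    by rewrite -mulr_sumr ler_pM2l ?exprn_gt0// sum_geometric_le.
  apply: ler_sum => k _; rewrite exprMn ler_pM2l ?exprn_gt0//.
  case/andP: hgamma => g0 g1; rewrite expr2.
  by apply: ler_piMr; [exact: exprn_ge0 (ltW g0)|exact: exprn_ile1 (ltW g0) (ltW g1)].
pose M := B + cE * (n%:R * (s0 ^+ 2 * (1 - gamma)^-1 * (d%:R * C))).
have MI T : (\int[P]_w (B + cE * \sum_(0 <= k < T) \sum_i N k i w)%:E <= M%:E)%E.
  apply: (le_trans (integral_affine_sum_le T mN N0 NI B0 cE0)).
  by rewrite lee_fin /M lerD2l ler_wpM2l// ler_pM2l.
have mB T : measurable_fun [set: Omega]
    (fun w => (B + cE * \sum_(0 <= k < T) \sum_i N k i w)%:E).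
  apply/measurable_EFinP/measurable_funD => //; apply: measurable_funM => //.
  by apply: measurable_sum => k; exact: measurable_sum.
(* Both claims follow from this bound, with [a = del] for the sum and [a = n] for the optimality
   gap; [M] does not depend on [T]. *)
have bound T a (h : Omega -> R) : 0 < a -> measurable_fun [set: Omega] h ->
    (forall w, 0 <= h w) ->
    (forall w, a * h w <= B + cE * \sum_(0 <= k < T) \sum_i N k i w) ->
    (`|\int[P]_w (h w)%:E| <= (M / a)%:E)%E.
  move=> a0 mh h0 hB; rewrite gee0_abs; last first.
    by apply: integral_ge0 => w _; rewrite lee_fin.
  have mhE : measurable_fun [set: Omega] (fun w => (h w)%:E) by exact/measurable_EFinP.
  rewrite mulrC EFinM lee_pdivlMl// -ge0_integralZl_EFin//; last 2 first.
    by move=> w _; rewrite lee_fin.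
    exact: ltW.
  apply: le_trans (MI T); apply: ge0_le_integral => //.
  - by move=> w _; rewrite -EFinM lee_fin mulr_ge0 ?(ltW a0).
  - exact: measurable_funeM.
  - by move=> w _; rewrite -EFinM lee_fin.
have mS k i : measurable_fun [set: Omega] (fun w => norm2 (x k i w - xbar k w) ^+ 2
    + norm2 (gradient (mean_fun f) (xbar k w)) ^+ 2).
  by apply: measurable_funD; apply: mvec_norm2_sqr => //; exact: mvecB.
split.
  exists (M / del) => T.
  have -> : (\sum_(0 <= k < T.+1) \sum_(i < n)
    'E_P[fun w => (norm2 (x k i w - xbar k w) ^+ 2
                   + norm2 (gradient (mean_fun f) (xbar k w)) ^+ 2)%R] =
      \int[P]_w (\sum_(0 <= k < T.+1) S k w)%:E)%E.
    under [RHS]eq_integral do rewrite -sumEFin.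
    rewrite ge0_integral_sum//; last 2 first.
      by move=> k; apply/measurable_EFinP; exact: measurable_sum.
      by move=> k w _; rewrite lee_fin.
    apply: eq_bigr => k _; under [RHS]eq_integral do rewrite /S -sumEFin.
    rewrite ge0_integral_sum//; last 2 first.
      by move=> i; exact/measurable_EFinP.
      by move=> i w _; rewrite lee_fin addr_ge0 ?sqr_ge0.
    by apply: eq_bigr => i _; rewrite unlock.
  (* The sum includes [k = T], hence [T.+1] telescoped steps; the optimality gap at time [T] needs
     only [T]. *)
  apply: (bound T.+1) => //.
  - by apply: measurable_sum => k; exact: measurable_sum.
  - by move=> w; apply: sumr_ge0.
  - move=> w; apply: le_trans (main T.+1 w); rewrite lerDr.
    by apply: mulr_ge0; [exact: ltW|exact: f0].
exists (M / n%:R) => T; rewrite unlock; apply: (bound T) => //.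
- apply: measurable_funB => //; apply: measurable_funM => //.
  apply: measurable_sum => i; apply: mvec_continuous => // z.
  exact: differentiable_continuous.
- move=> w; apply: le_trans (main T w); rewrite lerDl mulr_ge0 ?(ltW del0)//.
  exact: sumr_ge0.
Qed.
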